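(* Let $\mathbf P_0(\boldsymbol\mu)$ be the analytic total eigenprojector near $\boldsymbol\mu_0$ associated with the eigenvalue $\lambda_0$ of $\mathbf A(\boldsymbol\mu_0)$, with Taylor coefficients $\mathbf P_0^{(\boldsymbol\beta)}$ at $\boldsymbol\mu_0$; let $\mathbf U_0\in\mathbb C^{N\times m_0}$ have columns forming an orthonormal basis of $\operatorname{ran}\mathbf P_0(\boldsymbol\mu_0)$, and let $\mathbf K(\boldsymbol\mu)\in\mathbb C^{N\times m_0}$ be the analytic matrix function defined in the context, with Taylor coefficients $\mathbf K^{(\boldsymbol\beta)}$ at $\boldsymbol\mu_0$. Then, for every $n\in\mathbb N_0$, $$\operatorname{span}\{\operatorname{ran}\mathbf P_0^{(\boldsymbol\beta)}:|\boldsymbol\beta|\le n\}=\operatorname{span}\{\operatorname{ran}(\mathbf P_0^{(\boldsymbol\beta)}\mathbf U_0):|\boldsymbol\beta|\le n\}=\operatorname{span}\{\operatorname{ran}\mathbf U_0,\ \operatorname{ran}\mathbf K^{(\boldsymbol\beta)}:|\boldsymbol\beta|\le n\}.$$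
   Context: $\mathcal P\subseteq\mathbb R^d$ is open, $\boldsymbol\mu_0\in\mathcal P$, and $\mathbf A:\mathcal P\to\mathbb C^{N\times N}$ is Hermitian-matrix-valued and real-analytic (locally equal to its convergent multivariate power series). For $\boldsymbol\beta\in\mathbb N_0^d$, $|\boldsymbol\beta|=\beta_1+\dots+\beta_d$. $\lambda_0$ is an eigenvalue of $\mathbf A_0:=\mathbf A(\boldsymbol\mu_0)$ with multiplicity $m_0$ and orthogonal eigenprojector $\mathbf P_0$ (rank $m_0$). For $\boldsymbol\mu$ near $\boldsymbol\mu_0$, $\mathbf P_0(\boldsymbol\mu):=\frac{-1}{2\pi i}\oint_\Gamma(\mathbf A(\boldsymbol\mu)-\zeta\mathbf I)^{-1}d\zeta$, where $\Gamma$ is a closed contour encircling only the eigenvalue $\lambda_0$ of $\mathbf A_0$; it is an analytic orthogonal-projector-valued function commuting with $\mathbf A(\boldsymbol\mu)$, $\mathbf P_0(\boldsymbol\mu_0)=\mathbf P_0$, and $\mathbf P_0(\boldsymbol\mu)=\sum_{\boldsymbol\beta\in\mathbb N_0^d}(\boldsymbol\mu-\boldsymbol\mu_0)^{\boldsymbol\beta}\mathbf P_0^{(\boldsymbol\beta)}$. The matrix $\mathbf U_0\in\mathbb C^{N\times m_0}$ satisfies $\mathbf U_0^*\mathbf U_0=\mathbf I_{m_0}$, $\mathbf U_0\mathbf U_0^*=\mathbf P_0$. With $\mathbf P_0^\perp:=\mathbf I-\mathbf P_0$, set $$\mathbf U(\boldsymbol\mu):=\mathbf P_0(\boldsymbol\mu)\mathbf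 U_0,\quad \mathbf C(\boldsymbol\mu):=\mathbf U_0^*\mathbf P_0(\boldsymbol\mu)\mathbf U_0,\quad \mathbf K(\boldsymbol\mu):=\mathbf P_0^\perp\mathbf U(\boldsymbol\mu)\mathbf C(\boldsymbol\mu)^{-1},$$ where $\mathbf C(\boldsymbol\mu)$ is invertible for $\boldsymbol\mu$ near $\boldsymbol\mu_0$, and write $\mathbf K(\boldsymbol\mu)=\sum_{\boldsymbol\beta\in\mathbb N_0^d}(\boldsymbol\mu-\boldsymbol\mu_0)^{\boldsymbol\beta}\mathbf K^{(\boldsymbol\beta)}$. *)

(* Defs.v *)
From HB Require Import structures.
From mathcomp Require Import all_boot all_order all_algebra finmap.
From mathcomp Require Import complex sesquilinear spectral.
From mathcomp Require Import all_classical all_reals all_analysis.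
From mathcomp.analysis.showcase Require Import summability.

Set Implicit Arguments.
Unset Strict Implicit.
Unset Printing Implicit Defensive.

Import Order.TTheory GRing.Theory Num.Theory.
Import numFieldNormedType.Exports.

Local Open Scope classical_set_scope.
Local Open Scope complex_scope.
Local Open Scope sesquilinear_scope.
Local Open Scope ring_scope.

Definition multi_index (d : nat) := {ffun 'I_d -> nat}.

Definition mdegree (d : nat) (b : multi_index d) : nat := (\sum_(i < d) b i)%N.

Definition mpower (R : realType) (d : nat) (h : 'rV[R]_d) (b : multi_index d) : R :=
  \prod_(i < d) h ord0 i ^+ b i.

(* The power series converges unconditionally (equivalently, absolutely), i.e.
   along the net of finite sets of multi-indices, and its sum is f, on some
   neighbourhood of mu0. *)
Definition has_power_series (R : realType) (d m n : nat)
    (f : 'rV[R]_d -> 'M[R[i]]_(m, n)) (mu0 : 'rV[R]_d)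
    (c : multi_index d -> 'M[R[i]]_(m, n)) : Prop :=
  \forall mu \near mu0,
    partial_sum (fun b : multi_index d => (mpower (mu - mu0) b)%:C *: c b)
      @ totally --> (f mu : 'M[R[i]^o]_(m, n)).

Definition real_analytic_on (R : realType) (d m n : nat)
    (D : set 'rV[R]_d) (f : 'rV[R]_d -> 'M[R[i]]_(m, n)) : Prop :=
  forall mu1, D mu1 -> exists c, has_power_series f mu1 c.

(* A function is C^1 on a closed interval iff it coincides there with a
   function that is C^1 on the whole line. *)
Definition piecewise_C1 (R : realType) (f : R -> R) : Prop :=
  exists (k : nat) (s : nat -> R),
    [/\ s 0%N = 0, s k = 1,
        forall j, (j < k)%N -> s j < s j.+1
      & forall j, (j < k)%N -> exists g : R -> R,
          [/\ forall t, derivable g t 1,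
              continuous (derive1 g)
            & forall t, s j <= t <= s j.+1 -> f t = g t]].

(* Contours are parametrized by [0, 1]. *)
Definition closed_contour (R : realType) (gamma : R -> R[i]) : Prop :=
  [/\ piecewise_C1 (fun t => complex.Re (gamma t)),
      piecewise_C1 (fun t => complex.Im (gamma t))
    & gamma 0 = gamma 1].

(* The derivative is meaningless at the finitely many break points of gamma,
   which does not affect the integral. *)
Definition contour_deriv (R : realType) (gamma : R -> R[i]) (t : R) : R[i] :=
  derive1 (fun s => complex.Re (gamma s)) t
  +i* derive1 (fun s => complex.Im (gamma s)) t.

Definition contour_integral (R : realType) (gamma : R -> R[i])
    (f : R[i] -> R[i]) : R[i] :=
  (\int[lebesgue_measure]_(t in `[0, 1])
     complex.Re (f (gamma t) * contour_deriv gamma t))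
  +i*
  (\int[lebesgue_measure]_(t in `[0, 1])
     complex.Im (f (gamma t) * contour_deriv gamma t)).

Definition two_pi_i (R : realType) : R[i] := 0 +i* (2 * pi).

Definition winding_number (R : realType) (gamma : R -> R[i]) (z : R[i]) : R[i] :=
  (two_pi_i R)^-1 * contour_integral gamma (fun zeta => (zeta - z)^-1).

(* Among the eigenvalues of A0, gamma encircles lambda0 once, counterclockwise,
   and encircles no other one. *)
Definition encircles_only (R : realType) (N : nat) (gamma : R -> R[i])
    (A0 : 'M[R[i]]_N) (lambda0 : R[i]) : Prop :=
  [/\ closed_contour gamma,
      forall lambda, eigenvalue A0 lambda ->
        forall t, 0 <= t <= 1 -> gamma t != lambda,
      winding_number gamma lambda0 = 1
    & forall lambda, eigenvalue A0 lambda -> lambda != lambda0 ->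
        winding_number gamma lambda = 0].

Definition total_eigenprojector (R : realType) (d N : nat) (gamma : R -> R[i])
    (A : 'rV[R]_d -> 'M[R[i]]_N) (mu : 'rV[R]_d) : 'M[R[i]]_N :=
  \matrix_(i, j)
    (- 1 / two_pi_i R *
     contour_integral gamma (fun zeta => invmx (A mu - zeta%:M) i j)).

Definition ran (R : realType) (m n : nat) (M : 'M[R[i]]_(m, n)) : set 'cV[R[i]]_m :=
  range (fun v : 'cV[R[i]]_n => M *m v).

Definition orthogonal_eigenprojector (R : realType) (N : nat)
    (A0 : 'M[R[i]]_N) (lambda0 : R[i]) (P : 'M[R[i]]_N) : Prop :=
  [/\ P *m P = P, P ^t* = P
    & ran P = [set v | A0 *m v = lambda0 *: v]].

Definition lin_span (R : realType) (m : nat) (S : set 'cV[R[i]]_m) :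
    set 'cV[R[i]]_m :=
  [set v | exists (k : nat) (c : 'I_k -> R[i]) (u : 'I_k -> 'cV[R[i]]_m),
     (forall j, S (u j)) /\ v = \sum_(j < k) c j *: u j].

Definition Umx (R : realType) (d N m0 : nat) (P : 'rV[R]_d -> 'M[R[i]]_N)
    (U0 : 'M[R[i]]_(N, m0)) (mu : 'rV[R]_d) : 'M[R[i]]_(N, m0) :=
  P mu *m U0.

Definition Cmx (R : realType) (d N m0 : nat) (P : 'rV[R]_d -> 'M[R[i]]_N)
    (U0 : 'M[R[i]]_(N, m0)) (mu : 'rV[R]_d) : 'M[R[i]]_m0 :=
  U0 ^t* *m P mu *m U0.

Definition Kmx (R : realType) (d N m0 : nat) (P : 'rV[R]_d -> 'M[R[i]]_N)
    (P0 : 'M[R[i]]_N) (U0 : 'M[R[i]]_(N, m0)) (mu : 'rV[R]_d) :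
    'M[R[i]]_(N, m0) :=
  (1%:M - P0) *m Umx P U0 mu *m invmx (Cmx P U0 mu).

(* Main.v *)
Require Import Defs.
From HB Require Import structures.
From mathcomp Require Import all_boot all_order all_algebra finmap.
From mathcomp Require Import complex sesquilinear spectral.
From mathcomp Require Import all_classical all_reals all_analysis.
From mathcomp Require Import measurable_realfun.
From mathcomp Require Import ring lra zify.
From mathcomp.analysis.showcase Require Import summability.

Set Implicit Arguments.
Unset Strict Implicit.
Unset Printing Implicit Defensive.

Import Order.TTheory GRing.Theory Num.Theory.
Import numFieldNormedType.Exports ComplexField.Normc.

Local Open Scope classical_set_scope.
Local Open Scope complex_scope.
Local Open Scope sesquilinear_scope.
Local Open Scope ring_scope.

(** A linear span in C^N is determined by the row vectors w that annihilate it, and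
w annihilates the Taylor coefficients of order at most n of an analytic f
exactly when w f vanishes to order n + 1 at mu0.  So it is enough to show that,
for a fixed w,

    w P(mu),   w P(mu) U0   and   w (U0 + K(mu))

vanish to the same order, where P is the total eigenprojector.  They do because
near mu0 each is the product of another by a bounded matrix function:
- P is idempotent and close to P0, so W = 1 - (P - P0) is invertible, and
  P W = P P0 gives P = (P U0) (U0^* W^-1);
- C = U0^* P U0 is close to the identity, hence invertible with bounded
  inverse, and P U0 = (U0 + K) C since P0 + (1 - P0) = 1.
At mu0 one has P = P0 and K = 0, so that w (U0 + K) vanishes to positive order
if and only if w U0 = 0 and w K does ([projector_factor], [graph_factor]).
No Cauchy product of power series occurs.

Orders of vanishing are measured along one curve mu0 + h(t), t >= 0, with
h_i(t) = t^(e_i) and e_i = (n+1)^(d+1) + (n+1)^i.  Along it the monomial of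
exponent b becomes t^(e.b): the first summand of e_i makes the order grow with
the degree of b past degree n, and the second separates the monomials of degree
at most n, as the digits of a number written in base n + 1.  The coefficients of
degree at most n thus vanish exactly when the order in t is at least
(n+1)^(d+2) ([has_sums_vanishesP]).

The two facts about P that are used, P(mu0) = P0 and P(mu) P(mu) = P(mu) near
mu0, come from a diagonalization A(mu) = V^-1 diag(e) V.  The Riesz integral is
then V^-1 diag(winding numbers of the e_k) V, so it is idempotent as soon as
the winding numbers are 0 or 1.  They are so at mu0 by assumption; eigenvalues
move little with mu ([bauer_fike]) and the winding number is locally constant
([winding_number_near]): the difference of two winding integrals is the
increment over a closed path of the logarithm of (zeta - w) / (zeta - z), which
has a continuous branch when this quotient stays in the right half-plane. *)

(** * A submultiplicative norm on complex matrices *)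

(** The sum of the moduli of the entries.  Unlike the maximum, it is
submultiplicative on rectangular matrices with constant 1. *)
Definition l1norm (R : realType) (m n : nat) (M : 'M[R[i]]_(m, n)) : R :=
  \sum_i \sum_j normc (M i j).

Lemma normc_ge0 (R : realType) (x : R[i]) : 0 <= normc x.
Proof. by rewrite -lecR -[X in _ <= X]/(`|x|) normr_ge0. Qed.

Lemma normc_sum (R : realType) (I : Type) (r : seq I) (P : pred I)
  (F : I -> R[i]) : normc (\sum_(i <- r | P i) F i) <= \sum_(i <- r | P i) normc (F i).
Proof.
elim/big_rec2: _ => [|i y1 y2 _ IH]; first by rewrite normc0.
by apply: (le_trans (le_normcD _ _)); rewrite lerD2l.
Qed.

Lemma l1norm_ge0 (R : realType) m n (M : 'M[R[i]]_(m, n)) : 0 <= l1norm M.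
Proof. by do 2 (apply: sumr_ge0 => ? _); exact: normc_ge0. Qed.

Lemma l1norm0 (R : realType) m n : l1norm (0 : 'M[R[i]]_(m, n)) = 0.
Proof. by do 2 (apply: big1 => ? _); rewrite mxE normc0. Qed.

Lemma normc_le_l1norm (R : realType) m n (M : 'M[R[i]]_(m, n)) i j :
  normc (M i j) <= l1norm M.
Proof.
rewrite /l1norm (bigD1 i)//= (bigD1 j)//= -addrA lerDl addr_ge0//.
  by apply: sumr_ge0 => ? _; exact: normc_ge0.
by do 2 (apply: sumr_ge0 => ? _); exact: normc_ge0.
Qed.

Lemma l1norm_eq0 (R : realType) m n (M : 'M[R[i]]_(m, n)) : l1norm M <= 0 -> M = 0.
Proof.
move=> M0; apply/matrixP => i j; rewrite mxE; apply: eq0_normc.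
apply/eqP; rewrite eq_le normc_ge0 andbT.
exact: le_trans (normc_le_l1norm _ _ _) M0.
Qed.

Lemma l1normD (R : realType) m n (A B : 'M[R[i]]_(m, n)) :
  l1norm (A + B) <= l1norm A + l1norm B.
Proof.
rewrite /l1norm -big_split; apply: ler_sum => i _ /=.
by rewrite -big_split; apply: ler_sum => j _ /=; rewrite mxE le_normcD.
Qed.

Lemma l1norm_sum (R : realType) m n (I : Type) (r : seq I) (P : pred I)
  (F : I -> 'M[R[i]]_(m, n)) : l1norm (\sum_(i <- r | P i) F i) <= \sum_(i <- r | P i) l1norm (F i).
Proof.
elim/big_rec2: _ => [|i y1 y2 _ IH]; first by rewrite l1norm0.
by apply: (le_trans (l1normD _ _)); rewrite lerD2l.
Qed.

Lemma l1normN (R : realType) m n (A : 'M[R[i]]_(m, n)) : l1norm (- A) = l1norm A.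
Proof. by do 2 (apply: eq_bigr => ? _); rewrite mxE normcN. Qed.

Lemma l1normZ (R : realType) m n (a : R[i]) (A : 'M[R[i]]_(m, n)) :
  l1norm (a *: A) = normc a * l1norm A.
Proof.
rewrite /l1norm mulr_sumr; apply: eq_bigr => i _; rewrite mulr_sumr.
by apply: eq_bigr => j _; rewrite mxE normcM.
Qed.

Lemma l1norm1 (R : realType) n : l1norm (1%:M : 'M[R[i]]_n) = n%:R.
Proof.
rewrite /l1norm (eq_bigr (fun=> 1)) ?sumr_const ?card_ord// => i _.
rewrite (bigD1 i)//= big1 => [|j ji]; rewrite mxE ?eqxx ?normc1 ?addr0//.
by rewrite eq_sym (negbTE ji) normc0.
Qed.

Lemma l1normM (R : realType) m n p (A : 'M[R[i]]_(m, n)) (B : 'M[R[i]]_(n, p)) :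
  l1norm (A *m B) <= l1norm A * l1norm B.
Proof.
rewrite {1 2}/l1norm mulr_suml; apply: ler_sum => i _.
apply: (@le_trans _ _ (\sum_j \sum_k normc (A i k) * normc (B k j))).
  apply: ler_sum => j _; rewrite mxE; apply: (le_trans (normc_sum _ _ _)).
  by apply: ler_sum => k _; rewrite normcM.
rewrite exchange_big mulr_suml; apply: ler_sum => k _ /=.
rewrite -mulr_sumr ler_wpM2l ?normc_ge0//.
rewrite /l1norm [leRHS](bigD1 k)//= lerDl.
by do 2 (apply: sumr_ge0 => ? _); exact: normc_ge0.
Qed.

Lemma unitmx_kernel (F : fieldType) n (A : 'M[F]_n) :
  (forall v : 'rV_n, v *m A = 0 -> v = 0) -> A \in unitmx.
Proof.
move=> kerA; rewrite -row_free_unit -kermx_eq0.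
apply/eqP/row_matrixP => i; rewrite row0; apply: kerA.
by apply/sub_kermxP; exact: row_sub.
Qed.

(** The bound on the inverse X comes from X = 1 + X E, which gives
|X| <= n + |X| / 2. *)
Lemma invmx_1B_small (R : realType) n (E : 'M[R[i]]_n) : l1norm E <= 2^-1 ->
  1%:M - E \in unitmx /\ l1norm (invmx (1%:M - E)) <= 2 * n%:R.
Proof.
move=> E2.
have U : 1%:M - E \in unitmx.
  apply: unitmx_kernel => v; rewrite mulmxBr mulmx1 => /subr0_eq vE.
  apply: l1norm_eq0; have := l1normM v E; rewrite -vE.
  by have := l1norm_ge0 v; nra.
split=> //; set X := invmx _.
have XE : X = 1%:M + X *m E.
  by apply/eqP; rewrite -subr_eq -{1}[X]mulmx1 -mulmxBr mulVmx.
have := l1normD 1%:M (X *m E); rewrite -XE l1norm1 => h1.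
by have := l1normM X E; have := l1norm_ge0 X; nra.
Qed.

(** * Order of vanishing as t decreases to 0 *)

(** The bound is required at t = 0 too: for E > 0 it then contains M 0 = 0. *)
Definition vanishes_to_order (R : realType) (m n : nat) (E : nat)
    (M : R -> 'M[R[i]]_(m, n)) : Prop :=
  exists C t0, [/\ 0 <= C, 0 < t0 &
    forall t, 0 <= t <= t0 -> l1norm (M t) <= C * t ^+ E].

Definition near0_right (R : realType) (P : R -> Prop) : Prop :=
  exists2 t0, 0 < t0 & forall t, 0 <= t <= t0 -> P t.

Lemma near0_rightI (R : realType) (P Q : R -> Prop) :
  near0_right P -> near0_right Q ->
  near0_right (fun t => P t /\ Q t).
Proof.
move=> [a a0 Pa] [b b0 Qb]; exists (Num.min a b); first by rewrite lt_min a0.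
move=> t /andP[t0]; rewrite le_min => /andP[ta tb].
by split; [apply: Pa|apply: Qb]; rewrite t0.
Qed.

Lemma near0_right_imp (R : realType) (P Q : R -> Prop) :
  (forall t, P t -> Q t) -> near0_right P -> near0_right Q.
Proof. by move=> PQ [a a0 Pa]; exists a => // t /Pa /PQ. Qed.

Section order.
Variables (R : realType).

Lemma vanishesD m n E (M N : R -> 'M[R[i]]_(m, n)) :
  vanishes_to_order E M -> vanishes_to_order E N ->
  vanishes_to_order E (fun t => M t + N t).
Proof.
move=> [C [a [C0 a0 HM]]] [D [b [D0 b0 HN]]].
exists (C + D), (Num.min a b); split; rewrite ?addr_ge0 ?lt_min ?a0//.
move=> t /andP[t0]; rewrite le_min => /andP[ta tb].
apply: (le_trans (l1normD _ _)); rewrite mulrDl.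
by apply: lerD; [apply: HM|apply: HN]; rewrite t0.
Qed.

Lemma vanishesM m n p E F (M : R -> 'M[R[i]]_(m, n)) (N : R -> 'M[R[i]]_(n, p)) :
  vanishes_to_order E M -> vanishes_to_order F N ->
  vanishes_to_order (E + F) (fun t => M t *m N t).
Proof.
move=> [C [a [C0 a0 HM]]] [D [b [D0 b0 HN]]].
exists (C * D), (Num.min a b); split; rewrite ?mulr_ge0 ?lt_min ?a0//.
move=> t /andP[t0]; rewrite le_min => /andP[ta tb].
apply: (le_trans (l1normM _ _)); rewrite exprD mulrACA.
by apply: ler_pM; rewrite ?l1norm_ge0//; [apply: HM|apply: HN]; rewrite t0.
Qed.

Lemma vanishes_cst m n (M : 'M[R[i]]_(m, n)) : vanishes_to_order 0 ((fun=> M) : R -> _).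
Proof.
by exists (l1norm M), 1; split; rewrite ?l1norm_ge0// => t _; rewrite mulr1.
Qed.

Lemma vanishes_eq m n E (M N : R -> 'M[R[i]]_(m, n)) :
  near0_right (fun t => M t = N t) ->
  vanishes_to_order E M -> vanishes_to_order E N.
Proof.
move=> [b b0 MN] [C [a [C0 a0 HM]]].
exists C, (Num.min a b); split; rewrite ?lt_min ?a0//.
move=> t /andP[t0]; rewrite le_min => /andP[ta tb].
by rewrite -MN ?t0//; apply: HM; rewrite t0.
Qed.

Lemma vanishes_le m n E F (M : R -> 'M[R[i]]_(m, n)) : (E <= F)%N ->
  vanishes_to_order F M -> vanishes_to_order E M.
Proof.
move=> EF [C [a [C0 a0 HM]]].
exists C, (Num.min a 1); split; rewrite ?lt_min ?a0//=.
move=> t /andP[t0]; rewrite le_min => /andP[ta tb].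
apply: (@le_trans _ _ (C * t ^+ F)); first by apply: HM; rewrite t0.
by rewrite ler_wpM2l// ler_wiXn2l.
Qed.

Lemma vanishes_small m n (M : R -> 'M[R[i]]_(m, n)) e : 0 < e ->
  vanishes_to_order 1 M -> near0_right (fun t => l1norm (M t) <= e).
Proof.
move=> e0 [C [a [C0 a0 HM]]].
exists (Num.min a (e / (C + 1))).
  by rewrite lt_min a0 divr_gt0// ltr_wpDl.
move=> t /andP[t0]; rewrite le_min => /andP[ta].
rewrite ler_pdivlMr ?ltr_wpDl// => te.
by have := HM t; rewrite t0 ta expr1 => /(_ isT); nra.
Qed.

Lemma vanishes_at0 m n E (M : R -> 'M[R[i]]_(m, n)) :
  vanishes_to_order E.+1 M -> M 0 = 0.
Proof.
move=> [C [a [C0 a0 HM]]]; apply: l1norm_eq0.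
by have := HM 0; rewrite lexx ltW// expr0n mulr0 => /(_ isT).
Qed.

Lemma vanishes_invmx n (E : R -> 'M[R[i]]_n) : vanishes_to_order 1 E ->
  near0_right (fun t => 1%:M - E t \in unitmx) /\
  vanishes_to_order 0 (fun t => invmx (1%:M - E t)).
Proof.
move=> /(@vanishes_small _ _ _ 2^-1); rewrite invr_gt0 ltr0n => /(_ isT)[a a0 Ha].
split; first by exists a => // t /Ha /invmx_1B_small[].
exists (2 * n%:R), a; split; rewrite ?mulr_ge0// => t /Ha /invmx_1B_small[_].
by rewrite mulr1.
Qed.

End order.

(** * Unordered sums of matrices *)

Lemma partial_sumE (I : choiceType) (V : zmodType) (x : I -> V) (A : {fset I}) :
  partial_sum x A = \sum_(i <- A) x i.
Proof. by rewrite /partial_sum -(big_seq_fsetE _ _ predT). Qed.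

Lemma sum_fsetU (I : choiceType) (V : nmodType) (x : I -> V) (A B : {fset I}) :
  \sum_(i <- (A `|` B)%fset) x i = \sum_(i <- A) x i + \sum_(i <- (B `\` A)%fset) x i.
Proof.
rewrite -big_cat; apply: perm_big; apply: uniq_perm.
- exact: fset_uniq.
- rewrite cat_uniq !fset_uniq andbT /=; apply/hasPn => i.
  by rewrite !inE => /andP[].
- by move=> i; rewrite mem_cat !inE; case: (i \in A).
Qed.

(** Bounded finite sums force absolute summability: the terms of each sign form
a finite sum of their own. *)
Lemma sum_norm_le (R : realType) (I : choiceType) (y : I -> R) (B : R) :
  (forall J : {fset I}, `|\sum_(i <- J) y i| <= B) ->
  forall J : {fset I}, \sum_(i <- J) `|y i| <= 2 * B.
Proof.
move=> yB J.
have -> : \sum_(i <- J) `|y i| =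
    \sum_(i <- [fset i in J | 0 <= y i]%fset) y i
    - \sum_(i <- [fset i in J | ~~ (0 <= y i)]%fset) y i.
  rewrite !big_fset /= [LHS](bigID (fun i => 0 <= y i)) /=.
  congr (_ + _); first by apply: eq_bigr => i /ger0_norm.
  rewrite -sumrN; apply: eq_bigr => i; rewrite -ltNge => /ltW.
  exact: ler0_norm.
have := yB [fset i in J | 0 <= y i]%fset.
have := yB [fset i in J | ~~ (0 <= y i)]%fset.
by rewrite !ler_norml; lra.
Qed.

Lemma normc_ReIm (R : realType) (z : R[i]) :
  normc z <= `|complex.Re z| + `|complex.Im z|.
Proof.
case: z => a b /=; rewrite -[leRHS]ger0_norm ?addr_ge0//.
rewrite -sqrtr_sqr ler_wsqrtr// sqrrD !real_normK ?num_real//.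
by have := mulr_ge0 (normr_ge0 a) (normr_ge0 b); lra.
Qed.

Lemma normRe_le (R : realType) (z : R[i]) : `|complex.Re z| <= normc z.
Proof. by rewrite -lecR; exact: normc_ge_Re. Qed.

Lemma normIm_le (R : realType) (z : R[i]) : `|complex.Im z| <= normc z.
Proof.
case: z => a b /=; rewrite -sqrtr_sqr ler_wsqrtr// lerDr sqr_ge0//.
Qed.

Lemma sum_normc_le (R : realType) (I : choiceType) (x : I -> R[i]) (B : R) :
  (forall J : {fset I}, normc (\sum_(i <- J) x i) <= B) ->
  forall J : {fset I}, \sum_(i <- J) normc (x i) <= 4 * B.
Proof.
move=> xB J.
have hRe : \sum_(i <- J) `|complex.Re (x i)| <= 2 * B.
  apply: sum_norm_le => K; apply: le_trans (xB K).
  by have := normRe_le (\sum_(i <- K) x i); rewrite raddf_sum.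
have hIm : \sum_(i <- J) `|complex.Im (x i)| <= 2 * B.
  apply: sum_norm_le => K; apply: le_trans (xB K).
  by have := normIm_le (\sum_(i <- K) x i); rewrite raddf_sum.
apply: (@le_trans _ _ (\sum_(i <- J) (`|complex.Re (x i)| + `|complex.Im (x i)|))).
  by apply: ler_sum => i _; exact: normc_ReIm.
by rewrite big_split /=; lra.
Qed.

(** Convergence along the net of finite subsets, for the norm above; this is
all that is retained of the topology on matrices. *)
Definition sums_to (R : realType) (I : choiceType) m n (x : I -> 'M[R[i]]_(m, n))
    (M : 'M[R[i]]_(m, n)) : Prop :=
  forall e : R, 0 < e -> exists J0 : {fset I}, forall J : {fset I},
    (J0 `<=` J)%fset -> l1norm (M - \sum_(i <- J) x i) < e.

Lemma cvg_sums_to (R : realType) (I : choiceType) m n (x : I -> 'M[R[i]]_(m, n)) M :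
  partial_sum x @ totally --> (M : 'M[R[i]^o]_(m, n)) -> sums_to x M.
Proof.
move=> xM e e0.
pose e' := e / (m * n).+1%:R.
have e'0 : 0 < e'%:C :> R[i] by rewrite ltcR divr_gt0.
have [J0 _ HJ0] := xM _ (nbhsx_ballx (M : 'M[R[i]^o]_(m, n)) _ e'0).
exists J0 => J /HJ0 /= [_ HJ].
apply: (@le_lt_trans _ _ (\sum_(i < m) \sum_(j < n) e')).
  apply: ler_sum => i _; apply: ler_sum => j _; have := HJ i j.
  by rewrite /ball /= ltcR partial_sumE !mxE => /ltW.
rewrite !sumr_const !card_ord -!mulrnA -mulr_natr /e' -mulrA gtr_pMr//.
by rewrite ltr_pdivrMl// mulr1 ltr_nat mulnC.
Qed.

Lemma sums_to_mul (R : realType) (I : choiceType) p q m n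
    (x : I -> 'M[R[i]]_(m, n)) M (U : 'M[R[i]]_(p, m)) (V : 'M[R[i]]_(n, q)) :
  sums_to x M -> sums_to (fun b => U *m x b *m V) (U *m M *m V).
Proof.
move=> xM e e0.
have K0 : 0 < l1norm U * l1norm V + 1 by rewrite ltr_wpDl// mulr_ge0// l1norm_ge0.
have [J0 HJ0] := xM (e / (l1norm U * l1norm V + 1)) (divr_gt0 e0 K0).
exists J0 => J /HJ0; rewrite -mulmx_suml -mulmx_sumr -mulmxBl -mulmxBr.
set D := M - _; rewrite ltr_pdivlMr// => De.
apply: le_lt_trans De.
apply: (le_trans (l1normM _ _)).
have := ler_wpM2r (l1norm_ge0 V) (l1normM U D).
by have := l1norm_ge0 D; nra.
Qed.

Lemma sums_to_subdelta (R : realType) (I : choiceType) m n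
    (x : I -> 'M[R[i]]_(m, n)) M i0 (A : 'M[R[i]]_(m, n)) :
  sums_to x M -> sums_to (fun i => x i - (if i == i0 then A else 0)) (M - A).
Proof.
move=> xM e /xM[J0 HJ0]; exists (i0 |` J0)%fset => J.
rewrite fsubUset fsub1set => /andP[i0J J0J].
rewrite sumrB [X in _ - (_ - X)](big_fsetD1 i0)//= eqxx.
rewrite (_ : \sum_(i <- (J `\ i0)%fset) _ = 0); last first.
  by rewrite big_seq big1// => i; rewrite !inE => /andP[/negbTE ->].
by rewrite addr0 opprB addrA subrK HJ0.
Qed.

(** A finite sum over J is compared with the one over the union of J and J0,
which is close to M; the difference is a part of the sum over J0. *)
Lemma sums_to_bounded (R : realType) (I : choiceType) m n
    (x : I -> 'M[R[i]]_(m, n)) M : sums_to x M ->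
  exists B : R, 0 <= B /\ forall J : {fset I}, \sum_(b <- J) l1norm (x b) <= B.
Proof.
move=> /(_ 1 ltr01)[J0 HJ0].
set B := l1norm M + 1 + \sum_(i <- J0) l1norm (x i).
have S0 K : 0 <= \sum_(i <- K) l1norm (x i) by apply: sumr_ge0 => i _; exact: l1norm_ge0.
have B0 : 0 <= B by have := S0 J0; have := l1norm_ge0 M; rewrite /B; lra.
have nB (J : {fset I}) : l1norm (\sum_(i <- J) x i) <= B.
  have := HJ0 (J `|` J0)%fset (fsubsetUr _ _).
  rewrite sum_fsetU; set s := \sum_(i <- J) _; set r := \sum_(i <- _) _ => h.
  have hr : l1norm r <= \sum_(i <- J0) l1norm (x i).
    apply: (le_trans (l1norm_sum _ _ _)).
    rewrite [leRHS](big_fsetID _ (fun i => i \notin J)) /=.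
    have -> : (J0 `\` J)%fset = [fset i in J0 | i \notin J]%fset.
      by apply/fsetP => i; rewrite !inE andbC.
    by rewrite lerDl S0.
  have -> : s = M - (M - (s + r)) - r by rewrite subKr addrK.
  have h1 := l1normD (M - (M - (s + r))) (- r).
  have h2 := l1normD M (- (M - (s + r))).
  move: h1 h2; rewrite !l1normN /B => h1 h2; lra.
(* The factor 4: real and imaginary parts, each split by sign. *)
exists (\sum_(i < m) \sum_(j < n) 4 * B); split.
  by do 2 (apply: sumr_ge0 => ? _); lra.
move=> J; rewrite exchange_big; apply: ler_sum => i _ /=.
rewrite exchange_big; apply: ler_sum => j _ /=.
apply: sum_normc_le => K; apply: le_trans (nB K).
by have := normc_le_l1norm (\sum_(i <- K) x i) i j; rewrite summxE.
Qed.

Lemma sums_to_le (R : realType) (I : choiceType) m n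
    (x : I -> 'M[R[i]]_(m, n)) M (B : R) : sums_to x M ->
  (forall J : {fset I}, \sum_(b <- J) l1norm (x b) <= B) -> l1norm M <= B.
Proof.
move=> xM xB; apply/ler_addgt0Pr => e e0.
have [J0 /(_ _ (fsubset_refl _))] := xM e e0.
set s := \sum_(i <- J0) x i => h.
have -> : M = s + (M - s) by rewrite addrC subrK.
have := l1normD s (M - s); have := l1norm_sum J0 predT x; have := xB J0.
rewrite -/s; lra.
Qed.

(** * A curve on which distinct monomials have distinct orders *)

Lemma digits_inj (M d : nat) (b b' : 'I_d -> nat) :
  (forall i, b i < M)%N -> (forall i, b' i < M)%N ->
  (\sum_(i < d) b i * M ^ i = \sum_(i < d) b' i * M ^ i)%N -> b =1 b'.
Proof.
elim: d b b' => [|d IH] b b' bM b'M; first by move=> _ [].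
have S (c : 'I_d.+1 -> nat) : (\sum_(i < d.+1) c i * M ^ i =
    (\sum_(i < d) c (lift ord0 i) * M ^ i) * M + c ord0)%N.
  rewrite big_ord_recl expn0 muln1 addnC; congr (_ + _)%N.
  by rewrite big_distrl; apply: eq_bigr => i _; rewrite /bump /= -mulnA expnSr.
rewrite !S => e.
have M0 : (0 < M)%N by apply: leq_ltn_trans (bM ord0).
have e0 : b ord0 = b' ord0.
  by have := congr1 (modn^~ M) e; rewrite !modnMDl !modn_small.
have eS : (\sum_(i < d) b (lift ord0 i) * M ^ i)%N =
    (\sum_(i < d) b' (lift ord0 i) * M ^ i)%N.
  have := congr1 (divn^~ M) e.
  by rewrite !divnMDl// !divn_small// !addn0.
move=> i; case: (unliftP ord0 i) => [j ->|->//].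
exact: (IH (fun k => b (lift ord0 k)) (fun k => b' (lift ord0 k))).
Qed.

Section weights.
Variables (R : realType) (d n : nat).

(** The term with exponent d + 1 dominates, so that weighted degrees are ordered
by the degree first, up to degree n. *)
Definition weight (i : 'I_d) : nat := (n.+1 ^ d.+1 + n.+1 ^ i)%N.

Definition wcurve (t : R) : 'rV[R]_d := \row_i t ^+ weight i.

Definition wdegree (b : multi_index d) : nat := (\sum_(i < d) b i * weight i)%N.

Lemma mpower_wcurve t b : mpower (wcurve t) b = t ^+ wdegree b.
Proof.
rewrite /mpower /wdegree -prodrXr; apply: eq_bigr => i _.
by rewrite mxE -exprM mulnC.
Qed.

Lemma wdegreeE b :
  wdegree b = (mdegree b * n.+1 ^ d.+1 + \sum_(i < d) b i * n.+1 ^ i)%N.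
Proof.
by rewrite /wdegree /mdegree big_distrl -big_split; apply: eq_bigr => i _; rewrite mulnDr.
Qed.

Lemma sum_digits_lt b : (mdegree b <= n)%N ->
  (\sum_(i < d) b i * n.+1 ^ i < n.+1 ^ d.+1)%N.
Proof.
move=> bn; apply: (@leq_ltn_trans (n * n.+1 ^ d)%N).
  apply: (@leq_trans (mdegree b * n.+1 ^ d)%N); last by rewrite leq_mul2r bn orbT.
  rewrite /mdegree big_distrl; apply: leq_sum => i _.
  by rewrite leq_mul2l leq_pexp2l ?orbT// ltnW.
by rewrite expnS ltn_pmul2r ?expn_gt0.
Qed.

(** Up to degree n the digits contribute less than (n+1)^(d+1), so they cannot
make up for a difference of one in the degree. *)
Lemma wdegree_lt b : (wdegree b < n.+1 * n.+1 ^ d.+1)%N = (mdegree b <= n)%N.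
Proof.
apply/idP/idP => [|bn]; last first.
  rewrite wdegreeE mulSn addnC.
  by rewrite -addSn; apply: leq_add; [exact: sum_digits_lt|rewrite leq_mul2r bn orbT].
apply: contraLR; rewrite -!ltnNge ltnS wdegreeE => bn.
by apply: leq_trans (leq_addr _ _); rewrite leq_mul2r bn orbT.
Qed.

Lemma digit_le (b : multi_index d) i : (b i <= mdegree b)%N.
Proof. by rewrite /mdegree (bigD1 i)//= leq_addr. Qed.

Lemma wdegree_inj (b b' : multi_index d) :
  (mdegree b <= n)%N -> (mdegree b' <= n)%N ->
  wdegree b = wdegree b' -> b = b'.
Proof.
move=> bn b'n; rewrite !wdegreeE => e.
apply/ffunP; apply: (@digits_inj n.+1).
- by move=> i; rewrite ltnS (leq_trans (digit_le _ _)).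
- by move=> i; rewrite ltnS (leq_trans (digit_le _ _)).
- have := congr1 (modn^~ (n.+1 ^ d.+1)%N) e.
  by rewrite !modnMDl !modn_small ?sum_digits_lt.
Qed.

Lemma mdegree_eq0 (b : multi_index d) : mdegree b = 0%N -> b = [ffun=> 0%N].
Proof.
move=> b0; apply/ffunP => i; rewrite ffunE; apply/eqP.
by rewrite -leqn0 -b0 digit_le.
Qed.

Lemma wdegree0 (b : multi_index d) : (wdegree b < 1)%N -> b = [ffun=> 0%N].
Proof.
rewrite ltnS leqn0 wdegreeE addn_eq0 muln_eq0 expn_eq0 /= orbF => /andP[/eqP b0 _].
exact: mdegree_eq0.
Qed.

Lemma wcurve_near (mu0 : 'rV[R]_d) (P : set 'rV[R]_d) :
  (\forall mu \near mu0, P mu) -> near0_right (fun t => P (mu0 + wcurve t)).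
Proof.
move=> /nbhs_ballP[e /= e0 He].
(* Every weight is positive, so each coordinate of the curve is at most t
   for t <= 1. *)
exists (Num.min 1 (e / 2)); first by rewrite lt_min ltr01 divr_gt0.
move=> t /andP[t0]; rewrite le_min => /andP[t1 te].
apply: He; split => // i j; rewrite !mxE /ball /= opprD addrA subrr add0r normrN.
rewrite ger0_norm ?exprn_ge0// -[weight _]prednK; last by rewrite addn_gt0 expn_gt0.
apply: (@le_lt_trans _ _ t); last by lra.
by rewrite exprS ler_piMr// exprn_ile1.
Qed.

End weights.

Lemma wcurve0 (R : realType) d n : wcurve d n (0 : R) = 0.
Proof. by apply/rowP => i; rewrite !mxE expr0n addn_eq0 expn_eq0. Qed.

(** * Taylor coefficients and order of vanishing *)

Section power_series.
Variables (R : realType) (d : nat) (mu0 : 'rV[R]_d).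

Definition has_sums m n (f : 'rV[R]_d -> 'M[R[i]]_(m, n))
    (c : multi_index d -> 'M[R[i]]_(m, n)) : Prop :=
  \forall mu \near mu0,
    sums_to (fun b => (mpower (mu - mu0) b)%:C *: c b) (f mu).

Lemma has_power_series_sums m n (f : 'rV[R]_d -> 'M[R[i]]_(m, n)) c :
  has_power_series f mu0 c -> has_sums f c.
Proof. by apply: filterS => mu; exact: cvg_sums_to. Qed.

Lemma has_sums_mul p q m n (f : 'rV[R]_d -> 'M[R[i]]_(m, n)) c
    (U : 'M[R[i]]_(p, m)) (V : 'M[R[i]]_(n, q)) :
  has_sums f c ->
  has_sums (fun mu => U *m f mu *m V) (fun b => U *m c b *m V).
Proof.
apply: filterS => mu /(sums_to_mul U V).
by under eq_fun do rewrite -scalemxAr -scalemxAl.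
Qed.

Lemma has_sums_subM m n (f : 'rV[R]_d -> 'M[R[i]]_(m, n)) c
    (b0 : multi_index d) (M : 'M[R[i]]_(m, n)) :
  has_sums f c ->
  has_sums (fun mu => f mu - (mpower (mu - mu0) b0)%:C *: M)
    (fun b => c b - (if b == b0 then M else 0)).
Proof.
apply: filterS => mu /(sums_to_subdelta b0 ((mpower (mu - mu0) b0)%:C *: M)).
congr sums_to; apply/funext => b; rewrite scalerBr.
by case: eqP => [->//|_]; rewrite scaler0.
Qed.

(** At t0 the series converges absolutely; when t <= t0 each term is multiplied
by a power of t / t0 with exponent at least E. *)
Lemma has_sums_order m n (f : 'rV[R]_d -> 'M[R[i]]_(m, n)) c k E :
  has_sums f c ->
  (forall b, (wdegree k b < E)%N -> c b = 0) ->
  vanishes_to_order E (fun t => f (mu0 + wcurve d k t)).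
Proof.
move=> fc c0; have [t0 t00 Ht0] := wcurve_near k fc.
have l1norm_term t b : 0 <= t ->
    l1norm ((mpower (mu0 + wcurve d k t - mu0) b)%:C *: c b) =
    t ^+ wdegree k b * l1norm (c b).
  move=> t_ge0; rewrite addrC addKr mpower_wcurve l1normZ /=.
  by rewrite expr0n /= addr0 sqrtr_sqr ger0_norm ?exprn_ge0.
have [B [B0 HB]] : exists B : R, 0 <= B /\ forall J : {fset multi_index d},
    \sum_(b <- J) t0 ^+ wdegree k b * l1norm (c b) <= B.
  have [|B [B0 HB]] := sums_to_bounded (Ht0 t0 _); first by rewrite lexx ltW.
  exists B; split=> // J; apply: le_trans (HB J); apply: ler_sum => b _.
  by rewrite (l1norm_term _ _ (ltW t00)).
exists (B / t0 ^+ E), t0; split=> //; first by rewrite divr_ge0// exprn_ge0// ltW.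
move=> t tt0; have /andP[t_ge0 t_le] := tt0.
have r01 : 0 <= t / t0 <= 1.
  by rewrite divr_ge0 ?(ltW t00)//= ler_pdivrMr// mul1r.
rewrite -mulrA (mulrC _ (t ^+ E)) -expr_div_n mulrC.
apply: sums_to_le (Ht0 t tt0) _ => J.
apply: le_trans (ler_wpM2l _ (HB J)); last by rewrite exprn_ge0//; case/andP: r01.
rewrite mulr_sumr; apply: ler_sum => b _; rewrite l1norm_term//.
have [bE|Eb] := ltnP (wdegree k b) E; first by rewrite (c0 _ bE) l1norm0 !mulr0.
have -> : t ^+ wdegree k b = (t / t0) ^+ wdegree k b * t0 ^+ wdegree k b.
  by rewrite expr_div_n divfK// expf_neq0// gt_eqF.
rewrite -mulrA ler_wpM2r ?mulr_ge0 ?exprn_ge0 ?l1norm_ge0 ?(ltW t00)//.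
by case/andP: r01 => ? ?; rewrite ler_wiXn2l.
Qed.

Lemma has_sums_cont m n (f : 'rV[R]_d -> 'M[R[i]]_(m, n)) c k :
  has_sums f c ->
  vanishes_to_order 1 (fun t => f (mu0 + wcurve d k t) - f mu0).
Proof.
set z : multi_index d := [ffun=> 0%N].
move=> /(has_sums_subM z (c z)) /(has_sums_order (k := k) (E := 1)).
have z1 h : mpower h z = 1 :> R by rewrite /mpower big1// => i _; rewrite ffunE.
move=> Hf; have {}Hf : vanishes_to_order 1
    (fun t => f (mu0 + wcurve d k t) - c z).
  apply: vanishes_eq (Hf _); first by exists 1; [exact: ltr01|move=> t _]; rewrite z1 scale1r.
  by move=> b /wdegree0 ->; rewrite eqxx subrr.
have f0 : f mu0 = c z.
  by have := vanishes_at0 Hf; rewrite wcurve0 addr0 => /subr0_eq.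
by rewrite f0.
Qed.

(** The direct implication is [has_sums_order].  For the converse, a nonzero coefficient of least weighted degree e would leave a
term t^e that no other term can compensate, as the multi-indices of degree at
most k have distinct weighted degrees. *)
Lemma has_sums_vanishesP m n (f : 'rV[R]_d -> 'M[R[i]]_(m, n)) c k :
  has_sums f c ->
  (forall b, (mdegree b <= k)%N -> c b = 0) <->
  vanishes_to_order (k.+1 * k.+1 ^ d.+1) (fun t => f (mu0 + wcurve d k t)).
Proof.
move=> fc; split=> [c0|fE].
  by apply: has_sums_order fc _ => b; rewrite wdegree_lt => /c0.
suff H w b : wdegree k b = w -> (mdegree b <= k)%N -> c b = 0.
  by move=> b; exact: H.
elim/ltn_ind: w b => w IH b bw bk.
pose e := wdegree k b.
(* Once the term at b is removed, all remaining coefficients of weighted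
   degree at most e vanish: those of degree at most k by induction, the
   others because their weighted degree is beyond the threshold. *)
have h1 : vanishes_to_order e.+1
    (fun t => f (mu0 + wcurve d k t) - (t ^+ e)%:C *: c b).
  have := has_sums_order (k := k) (E := e.+1)
    (has_sums_subM b (c b) fc).
  move=> Hf; apply: vanishes_eq (Hf _).
    exists 1; [exact: ltr01|move=> t _].
    have -> : mu0 + wcurve d k t - mu0 = wcurve d k t by rewrite addrC addKr.
    by rewrite mpower_wcurve.
  move=> b'; case: eqP => [->|b'b]; first by rewrite subrr.
  rewrite ltnS subr0 => b'e.
  have b'k : (mdegree b' <= k)%N.
    rewrite -wdegree_lt; apply: leq_ltn_trans b'e _.
    by rewrite wdegree_lt.
  apply: (IH (wdegree k b')) => //; rewrite -bw ltn_neqAle b'e andbT.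
  by apply/eqP => /(wdegree_inj b'k bk).
have h2 : vanishes_to_order e.+1 (fun t => f (mu0 + wcurve d k t)).
  by apply: vanishes_le fE; rewrite wdegree_lt.
have [C [a [C0 a0 Ha]]] : vanishes_to_order e.+1 (fun t => (- t ^+ e)%:C *: c b).
  have [C [a [C0 a0 Ha]]] := h2; have h3 : vanishes_to_order e.+1 (fun t => - f (mu0 + wcurve d k t)).
    by exists C, a; split=> // t /Ha; rewrite l1normN.
  apply: vanishes_eq (vanishesD h1 h3).
  by exists 1; [exact: ltr01|move=> t _]; rewrite rmorphN scaleNr addrC addKr.
apply: l1norm_eq0; apply/ler_addgt0Pr => eps eps0; rewrite add0r.
pose t := Num.min a (eps / (C + 1)).
have C1 : 0 < C + 1 by rewrite ltr_wpDl.
have t0 : 0 < t by rewrite lt_min a0 divr_gt0.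
have := Ha t; rewrite (ltW t0) ge_min lexx => /(_ isT).
rewrite l1normZ rmorphN normcN /= expr0n /= addr0 sqrtr_sqr ger0_norm ?exprn_ge0 ?(ltW t0)//.
rewrite exprS mulrA [leLHS]mulrC ler_pM2r ?exprn_gt0//.
have : t <= eps / (C + 1) by rewrite ge_min lexx orbT.
rewrite ler_pdivlMr// => h h'; apply: le_trans h' _; lra.
Qed.

End power_series.

Lemma has_sums_mull (R : realType) d (mu0 : 'rV[R]_d) p m n
    (f : 'rV[R]_d -> 'M[R[i]]_(m, n)) c (U : 'M[R[i]]_(p, m)) :
  has_sums mu0 f c -> has_sums mu0 (fun mu => U *m f mu) (fun b => U *m c b).
Proof.
move=> /(has_sums_mul U 1%:M).
by under eq_fun do rewrite mulmx1; under [X in has_sums _ _ X]eq_fun do rewrite mulmx1.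
Qed.

(** * Spans and annihilating row vectors *)

Lemma submx_annihilator (F : fieldType) m n p (A : 'M[F]_(p, m)) (B : 'M[F]_(n, m)) :
  (forall w : 'cV_m, B *m w = 0 -> A *m w = 0) -> (A <= B)%MS.
Proof.
move=> H; rewrite submxE; apply/eqP/trmx_inj/row_matrixP => i.
rewrite trmx0 row0 trmx_mul row_mul; apply: trmx_inj.
rewrite trmx_mul trmxK trmx0; apply: H; apply: trmx_inj.
rewrite trmx_mul trmxK trmx0 -row_mul -[B in B^T](trmxK) -trmx_mul.
by rewrite trmxK mulmx_coker trmx0 row0.
Qed.

(** Rows taken from S are collected as long as the rank grows.  If v is not yet
spanned, some w kills the rows but not v, hence not all of S, and an element
of S that w does not kill increases the rank. *)
Lemma lin_span_annihilator (R : realType) m (S : set 'cV[R[i]]_m) (v : 'cV_m) :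
  (forall w : 'rV_m, (forall u, S u -> w *m u = 0) -> w *m v = 0) ->
  lin_span S v.
Proof.
move=> Sv.
suff H r k (B : 'M[R[i]]_(k, m)) : (m - \rank B = r)%N ->
    (forall i, S (row i B)^T) -> lin_span S v.
  by apply: (H _ 0%N 0 erefl) => -[].
elim/ltn_ind: r k B => r IH k B Br SB.
have [vB|vB] := boolP (v^T <= B)%MS.
  have /submxP[y vy] := vB; exists k, (y 0), (fun i => (row i B)^T); split=> //.
  apply: trmx_inj; rewrite vy mulmx_sum_row raddf_sum; apply: eq_bigr => j _.
  by apply/matrixP => a b /=; rewrite !mxE.
have [w wB wv] : exists2 w : 'cV_m, B *m w = 0 & v^T *m w <> 0.
  apply/not_exists2P => H; move/negP: vB; apply.
  apply: submx_annihilator => w wB.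
  by case: (H w) => // /contrapT.
have [u Su wu] : exists2 u, S u & w^T *m u <> 0.
  apply/not_exists2P => H; apply: wv; apply: trmx_inj.
  rewrite trmx_mul trmxK trmx0; apply: Sv => u Su.
  by case: (H u) => // /contrapT.
(* The vector w^T kills the rows of B but not u, so u^T is not spanned. *)
have BB' : (B < col_mx B u^T)%MS.
  rewrite ltmxE col_mx_sub submx_refl /= -addsmxE addsmxSl /=.
  apply/negP => /submxP[y uy]; apply: wu; apply: trmx_inj.
  by rewrite trmx_mul trmxK trmx0 uy -mulmxA wB mulmx0.
apply: (IH (m - \rank (col_mx B u^T))%N _ _ (col_mx B u^T) erefl).
  rewrite -Br ltn_sub2l// ?rank_ltmx//.
  by apply: leq_trans (rank_ltmx BB') _; exact: rank_leq_col.
move=> i; case: (split_ordP i) => j ->; first by rewrite rowKu.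
by rewrite rowKd row_id trmxK.
Qed.

Lemma lin_span_subset (R : realType) m (S T : set 'cV[R[i]]_m) :
  (forall w : 'rV_m, (forall u, S u -> w *m u = 0) ->
     forall u, T u -> w *m u = 0) ->
  lin_span T `<=` lin_span S.
Proof.
move=> ST v [k [c [u [Tu ->]]]]; apply: lin_span_annihilator => w Sw.
rewrite mulmx_sumr big1// => j _.
by rewrite -scalemxAr (ST w Sw) ?scaler0.
Qed.

Lemma annihilates_ranP (R : realType) m n (M : 'M[R[i]]_(m, n)) (w : 'rV_m) :
  (forall u, ran M u -> w *m u = 0) <-> w *m M = 0.
Proof.
split=> [H|wM _ [v _ <-]]; last by rewrite mulmxA wM mul0mx.
apply/matrixP => i j.
have /(H _) /matrixP /(_ i 0) : ran M (M *m delta_mx j 0) by exists (delta_mx j 0).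
by rewrite mulmxA -colE !mxE.
Qed.

Lemma annihilates_bigcup_ranP (R : realType) d m k n
    (M : multi_index d -> 'M[R[i]]_(m, k)) (w : 'rV_m) :
  (forall u, (\bigcup_(b in [set b | (mdegree b <= n)%N]) ran (M b)) u -> w *m u = 0) <->
  (forall b, (mdegree b <= n)%N -> w *m M b = 0).
Proof.
split=> [H b bn|H u [b bn ub]].
  by apply/annihilates_ranP => u ub; apply: H; exists b.
by have /annihilates_ranP := H b bn; apply.
Qed.

(** * Derivatives of the logarithm of a quotient *)

Section derivatives.
Variable R : realType.
Implicit Types (f g u v : R -> R) (a b c p q t : R).

Let isdB f g t a b : is_derive t 1 f a -> is_derive t 1 g b ->
  is_derive t 1 (fun s => f s - g s) (a - b).
Proof. by move=> hf hg; exact: (is_deriveB hf hg). Qed.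

Let isdD f g t a b : is_derive t 1 f a -> is_derive t 1 g b ->
  is_derive t 1 (fun s => f s + g s) (a + b).
Proof. by move=> hf hg; exact: (is_deriveD hf hg). Qed.

Let isdBc f t a c : is_derive t 1 f a -> is_derive t 1 (fun s => f s - c) a.
Proof.
move=> hf; have := isdB hf (is_derive_cst c t 1).
by rewrite subr0.
Qed.

Let isdM f g t a b : is_derive t 1 f a -> is_derive t 1 g b ->
  is_derive t 1 (fun s => f s * g s) (f t * b + g t * a).
Proof. by move=> hf hg; exact: (is_deriveM hf hg). Qed.

Let isdV f t a : is_derive t 1 f a -> f t != 0 ->
  is_derive t 1 (fun s => (f s)^-1) (- (f t ^- 2 * a)).
Proof. by move=> hf f0; apply: is_derive_eq (is_deriveV f0 hf) _; rewrite scaleNr. Qed.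

Let isd_comp h f t a c : is_derive t 1 f a -> is_derive (f t) 1 h c ->
  is_derive t 1 (fun s => h (f s)) (c * a).
Proof. by move=> hf hh; exact: (is_derive1_comp hh hf). Qed.

(** With zeta = u + i v and z = p + i q, this is the real part of
zeta' / (zeta - z), the logarithmic derivative of zeta - z. *)
Lemma is_derive_ln_dist u v t a b p q :
  is_derive t 1 u a -> is_derive t 1 v b ->
  0 < (u t - p) ^+ 2 + (v t - q) ^+ 2 ->
  is_derive t 1 (fun s => ln ((u s - p) ^+ 2 + (v s - q) ^+ 2) * 2^-1)
    (((u t - p) * a + (v t - q) * b) / ((u t - p) ^+ 2 + (v t - q) ^+ 2)).
Proof.
move=> hu hv N0.
have hp := isdBc p hu; have hq := isdBc q hv.
have hN : is_derive t 1 (fun s => (u s - p) ^+ 2 + (v s - q) ^+ 2) _ :=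
  isdD (isdM hp hp) (isdM hq hq).
have hc := isd_comp hN (is_derive1_ln N0).
have := isdM hc (is_derive_cst (2^-1 : R) t 1); rewrite mulr0 add0r => h.
apply: (is_derive_eq h); rewrite /cst; field; exact: lt0r_neq0.
Qed.

(** With z = p + i q and z' = p' + i q', the angle is the argument of
(zeta - z) / (zeta - z'), on the half-plane where its real part is positive:
the quotient has the direction of (zeta - z) times the conjugate of
(zeta - z'). *)
Lemma is_derive_arg_ratio u v t a b p q p' q' :
  is_derive t 1 u a -> is_derive t 1 v b ->
  0 < (u t - p) * (u t - p') + (v t - q) * (v t - q') ->
  is_derive t 1
    (fun s => atan (((v s - q) * (u s - p') - (u s - p) * (v s - q')) /
                    ((u s - p) * (u s - p') + (v s - q) * (v s - q'))))
    (((u t - p) * b - (v t - q) * a) / ((u t - p) ^+ 2 + (v t - q) ^+ 2) -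
     ((u t - p') * b - (v t - q') * a) / ((u t - p') ^+ 2 + (v t - q') ^+ 2)).
Proof.
move=> hu hv A0.
have hp := isdBc p hu; have hq := isdBc q hv.
have hp' := isdBc p' hu; have hq' := isdBc q' hv.
have hA := isdD (isdM hp hp') (isdM hq hq').
have hB := isdB (isdM hq hp') (isdM hp hq').
have hq0 := isdM hB (isdV hA (lt0r_neq0 A0)).
have hc := isd_comp hq0 (is_derive1_atan _).
apply: (is_derive_eq hc); rewrite /GRing.scale /=.
move: A0; set x := u t - p; set y := v t - q; set x' := u t - p'; set y' := v t - q' => A0.
have N0 : x ^+ 2 + y ^+ 2 != 0.
  rewrite paddr_eq0 ?sqr_ge0// !sqrf_eq0; apply/negP => /andP[/eqP x0 /eqP y0].
  by move: A0; rewrite x0 y0 !mul0r addr0 ltxx.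
have N'0 : x' ^+ 2 + y' ^+ 2 != 0.
  rewrite paddr_eq0 ?sqr_ge0// !sqrf_eq0; apply/negP => /andP[/eqP x0 /eqP y0].
  by move: A0; rewrite x0 y0 !mulr0 addr0 ltxx.
have NN : (x * x' + y * y') ^+ 2 + (y * x' - x * y') ^+ 2 != 0.
  rewrite (_ : _ + _ = (x ^+ 2 + y ^+ 2) * (x' ^+ 2 + y' ^+ 2)); last by ring.
  by rewrite mulf_neq0.
field.
by rewrite N0 N'0 NN lt0r_neq0.
Qed.

End derivatives.

(** * Piecewise arguments on an interval *)

(** An inductive form of the subdivisions of [a, b] into pieces satisfying Q:
properties compatible with concatenation follow by induction, and common
refinements need no bookkeeping of break points. *)
Inductive piecewise (R : realType) (Q : R -> R -> Prop) : R -> R -> Prop :=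
| piecewise_one a b : a < b -> Q a b -> piecewise Q a b
| piecewise_cat a b c : piecewise Q a b -> piecewise Q b c -> piecewise Q a c.

Section piecewise_theory.
Variable R : realType.
Implicit Types (a b c d t : R) (Q : R -> R -> Prop).

Definition hereditary Q := forall a b c d,
  a <= c -> c < d -> d <= b -> Q a b -> Q c d.

Lemma piecewise_lt Q a b : piecewise Q a b -> a < b.
Proof. by elim=> [//|? ? ? _ ? _]; exact: lt_trans. Qed.

Lemma piecewise_sub Q a b c d : hereditary Q -> piecewise Q a b ->
  a <= c -> c < d -> d <= b -> piecewise Q c d.
Proof.
move=> hQ ab; elim: ab c d => {a b} [a b ab Qab|a b e ab IHa be IHb] c d ac cd db.
- by apply: piecewise_one => //; exact: hQ Qab.
- have [db'|bd] := leP d b; first exact: IHa.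
  have [bc|cb] := leP b c; first exact: IHb.
  by apply: (@piecewise_cat _ _ _ b); [exact: IHa|exact: IHb].
Qed.

(** Common refinement: inside one piece for Q1, every piece for Q2 satisfies Q1
as well, since Q1 passes to subintervals. *)
Lemma piecewise_and Q1 Q2 a b : hereditary Q1 -> hereditary Q2 ->
  piecewise Q1 a b -> piecewise Q2 a b ->
  piecewise (fun c d => Q1 c d /\ Q2 c d) a b.
Proof.
move=> h1 h2; elim=> {a b} [a b ab Q1ab Q2ab|a b c ab IHa bc IHb ac].
- suff H c d : piecewise Q2 c d -> a <= c -> d <= b ->
      piecewise (fun c d => Q1 c d /\ Q2 c d) c d by exact: H.
  elim=> {c d} [c d cd Q2cd ac db|c d e cd IHc de IHd ac eb].
  + by apply: piecewise_one => //; split=> //; exact: h1 Q1ab.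
  + apply: piecewise_cat (IHc ac _) (IHd _ eb).
      exact: le_trans (ltW (piecewise_lt de)) eb.
    exact: le_trans ac (ltW (piecewise_lt cd)).
- have [ab' bc'] := (piecewise_lt ab, piecewise_lt bc).
  by apply: piecewise_cat (IHa _) (IHb _); apply: piecewise_sub ac _ _ _ => //; exact: ltW.
Qed.

Lemma piecewise_ind_itv Q (P : R -> R -> Prop) a b : piecewise Q a b ->
  (forall c d, a <= c -> c < d -> d <= b -> Q c d -> P c d) ->
  (forall c d e, c < d -> d < e -> P c d -> P d e -> P c e) -> P a b.
Proof.
move=> ab P1 P2.
suff H c d : piecewise Q c d -> a <= c -> d <= b -> P c d by exact: H.
elim=> {c d} [c d cd Qcd ac db|c d e cd IHc de IHd ac eb]; first exact: P1.
have [cd' de'] := (piecewise_lt cd, piecewise_lt de).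
apply: (P2 _ d) => //; [apply: IHc|apply: IHd] => //.
  exact: le_trans (ltW de') eb.
exact: le_trans ac (ltW cd').
Qed.

Definition agrees_C1 (f : R -> R) a b := exists g : R -> R,
  [/\ forall t, derivable g t 1, continuous (derive1 g)
    & forall t, a <= t <= b -> f t = g t].

Lemma agrees_C1_hereditary f : hereditary (agrees_C1 f).
Proof.
move=> a b c d ac cd db [g [gd gc fg]]; exists g; split=> // t /andP[ct td].
by apply: fg; rewrite (le_trans ac ct) (le_trans td db).
Qed.

Lemma piecewise_C1P f : piecewise_C1 f -> piecewise (agrees_C1 f) 0 1.
Proof.
move=> [k [s [s0 sk slt sC1]]].
case: k sk slt sC1 => [|k] sk slt sC1; first by have := @oner_neq0 R; rewrite -sk s0 eqxx.
rewrite -s0 -sk.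
suff H j : (j < k.+1)%N -> piecewise (agrees_C1 f) (s 0%N) (s j.+1) by exact: H.
elim: j => [jk|j IH jk]; first by apply: piecewise_one; [exact: slt|exact: sC1].
apply: (piecewise_cat (IH (ltnW jk))).
by apply: piecewise_one; [exact: slt|exact: sC1].
Qed.

End piecewise_theory.

(** * Integration of a function known inside an interval *)

Section integration.
Variable R : realType.
Notation mu := (@lebesgue_measure R).
Implicit Types (a b c d t : R) (h f F G : R -> R).

(** This serves for an integrand h built from the derivative of a piecewise
smooth function, whose values at the break points are arbitrary: they only
matter on a null set. *)
Lemma integrable_eq_oo a b h f : a < b ->
  {within `[a, b], continuous f} -> {in `]a, b[, h =1 f} ->
  mu.-integrable `[a, b] (EFin \o h) /\
  \int[mu]_(t in `[a, b]) h t = \int[mu]_(t in `[a, b]) f t.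
Proof.
move=> ab fc hf.
have fi : mu.-integrable `[a, b] (EFin \o f).
  by apply: continuous_compact_integrable => //; exact: segment_compact.
have fo : mu.-integrable `]a, b[ (EFin \o f).
  by apply: integrableS fi => //; exact: subset_itv_oo_cc.
have ho : mu.-integrable `]a, b[ (EFin \o h).
  apply: eq_integrable fo => // t; rewrite inE => /= tab.
  by rewrite hf.
have mho := measurable_int mu ho; have mfo := measurable_int mu fo.
split.
  have mab : measurable ([set a; b] : set (measurableTypeR R)).
    exact: (measurableU _ _ (measurable_set1 a) (measurable_set1 b)).
  have ab0 : mu [set a; b] = 0%E.
    by rewrite measureU0//; exact: lebesgue_measure_set1.
  have mh := emeasurable_fun_itv_cc mho.
  apply: (negligible_integrable mab _ mh ab0).2 => //.
  have -> : `[a, b] `\` [set a; b] = `]a, b[%classic => //.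
  apply/seteqP; split=> t /=; rewrite !in_itv /=.
    move=> [/andP[at_ tb] /not_orP[/eqP ta /eqP tb']].
    by rewrite !lt_neqAle at_ tb tb' eq_sym ta.
  move=> /andP[at_ tb]; split; first by rewrite !ltW.
  by case=> tE; move: at_ tb; rewrite tE ltxx.
rewrite /Rintegral; congr fine.
rewrite (integral_itv_bndoo _ _ mho) (integral_itv_bndoo _ _ mfo).
by apply: eq_integral => t; rewrite inE /= => tab; rewrite hf.
Qed.

Lemma integrable_itv_cat a b c h : a <= b -> b <= c ->
  mu.-integrable `[a, b] (EFin \o h) -> mu.-integrable `[b, c] (EFin \o h) ->
  mu.-integrable `[a, c] (EFin \o h).
Proof.
move=> ab bc h1 h2.
have h2' : mu.-integrable `]b, c] (EFin \o h).
  by apply: integrableS h2 => //; apply: subset_itvr; rewrite bnd_simp.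
have mk (i : interval R) := @integrable_mkcond _ _ _ mu [set` i] (EFin \o h) (measurable_itv i).
apply: (mk _).2; have {}h1 := (mk _).1 h1; have {}h2' := (mk _).1 h2'.
apply: eq_integrable (integrableD _ h1 h2') => //= t _.
rewrite !patchE !mem_setE !in_itv /=.
case: (leP a t) => at_ /=; last first.
  by rewrite (ltNge b) (le_trans (ltW at_) ab) /= adde0.
case: (leP t b) => tb /=; first by rewrite (le_trans tb bc) adde0.
by rewrite add0e.
Qed.

Lemma Rintegral_itv_cat a b c h : a <= b -> b <= c ->
  mu.-integrable `[a, c] (EFin \o h) ->
  \int[mu]_(t in `[a, c]) h t = \int[mu]_(t in `[a, b]) h t + \int[mu]_(t in `[b, c]) h t.
Proof.
move=> ab bc hi.
have hbc : mu.-integrable `]b, c] (EFin \o h).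
  apply: integrableS hi => // t /=; rewrite !in_itv /= => /andP[bt ->].
  by rewrite (le_trans ab (ltW bt)).
rewrite -(Rintegral_itv_obnd_cbnd hbc) -(Rintegral_itvB hi) ?bnd_simp//.
by rewrite addrC subrK.
Qed.

Lemma Rintegral_FTC a b h f F : a < b ->
  (forall t, a <= t <= b -> is_derive t 1 F (f t)) ->
  {within `[a, b], continuous f} -> {in `]a, b[, h =1 f} ->
  \int[mu]_(t in `[a, b]) h t = F b - F a.
Proof.
move=> ab dF fc hf; rewrite (integrable_eq_oo ab fc hf).2 /Rintegral.
have Fc t : a <= t <= b -> {for t, continuous F}.
  move=> /dF Ft; apply: differentiable_continuous; apply/derivable1_diffP.
  exact: ex_derive.
have aab : a <= a <= b by rewrite lexx ltW.
have abb : a <= b <= b by rewrite lexx ltW.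
rewrite (@continuous_FTC2 _ f F)//.
- split.
  + move=> t; rewrite in_itv /= => /andP[at_ tb].
    by apply: ex_derive; apply: dF; rewrite !ltW.
  + exact: cvg_at_right_filter (Fc _ aab).
  + exact: cvg_at_left_filter (Fc _ abb).
- move=> t; rewrite in_itv /= => /andP[at_ tb].
  by rewrite derive1E; apply: derive_val; apply: dF; rewrite !ltW.
Qed.

End integration.

(** * Contours and winding numbers *)

Section contours.
Variable R : realType.
Notation mu := (@lebesgue_measure R).
Implicit Types (a b c d t : R) (gamma : R -> R[i]) (z w : R[i]).

(** Squared distances are polynomial in the coordinates, hence smooth and easier
to differentiate than moduli. *)
Definition sqdist w z : R :=
  (complex.Re w - complex.Re z) ^+ 2 + (complex.Im w - complex.Im z) ^+ 2.

Lemma sqdistE w z : sqdist w z = normc (w - z) ^+ 2.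
Proof. by case: w z => [a b] [c d]; rewrite /sqdist /= sqr_sqrtr ?addr_ge0 ?sqr_ge0. Qed.

Lemma sqdist_gt0 w z : (0 < sqdist w z) = (w != z).
Proof.
rewrite lt_def addr_ge0 ?sqr_ge0// andbT; congr negb.
rewrite paddr_eq0 ?sqr_ge0// !sqrf_eq0 !subr_eq0.
by case: w z => [a b] [c d]; rewrite eq_complex.
Qed.

Lemma Re_invM w z : complex.Re (w^-1 * z) =
  (complex.Re w * complex.Re z + complex.Im w * complex.Im z) /
  (complex.Re w ^+ 2 + complex.Im w ^+ 2).
Proof. by case: w z => [a b] [c d] /=; ring. Qed.

Lemma Im_invM w z : complex.Im (w^-1 * z) =
  (complex.Re w * complex.Im z - complex.Im w * complex.Re z) /
  (complex.Re w ^+ 2 + complex.Im w ^+ 2).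
Proof. by case: w z => [a b] [c d] /=; ring. Qed.

Definition smooth_piece gamma a b :=
  agrees_C1 (fun t => complex.Re (gamma t)) a b /\
  agrees_C1 (fun t => complex.Im (gamma t)) a b.

Lemma closed_contour_piecewise gamma :
  closed_contour gamma -> piecewise (smooth_piece gamma) 0 1.
Proof.
move=> [/piecewise_C1P hx /piecewise_C1P hy _].
by apply: piecewise_and => //; exact: agrees_C1_hereditary.
Qed.

Lemma agrees_C1_derive (f g : R -> R) a b t : a < t < b ->
  (forall t, a <= t <= b -> f t = g t) -> derive1 f t = derive1 g t.
Proof.
move=> tab fg; rewrite !derive1E; apply: near_eq_derive.
have tI : t \in `]a, b[ by rewrite in_itv.
apply: filterS (near_in_itvoo tI) => s; rewrite in_itv /= => /andP[sa sb].
by apply: fg; rewrite !ltW.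
Qed.

Lemma smooth_pieceP gamma a b : smooth_piece gamma a b ->
  exists u v du dv : R -> R,
  [/\ forall t, is_derive t 1 u (du t) /\ is_derive t 1 v (dv t),
      continuous du /\ continuous dv,
      forall t, a <= t <= b -> gamma t = u t +i* v t
    & forall t, a < t < b -> contour_deriv gamma t = du t +i* dv t].
Proof.
move=> [[u [ud uc ue]] [v [vd vc ve]]]; exists u, v, (derive1 u), (derive1 v); split=> //.
- by move=> t; rewrite !derive1E; split; apply/derivableP.
- by move=> t tab; rewrite -ue// -ve//; case: (gamma t).
- by move=> t tab; rewrite /contour_deriv (agrees_C1_derive tab ue) (agrees_C1_derive tab ve).
Qed.

Lemma is_derive_continuous (f : R -> R) t df : is_derive t 1 f df -> {for t, continuous f}.
Proof.
by move=> ?; apply: differentiable_continuous; apply/derivable1_diffP; exact: ex_derive.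
Qed.

(** On each smooth piece the squared distance is continuous on a compact
interval, so it attains its minimum. *)
Lemma contour_gap gamma z : closed_contour gamma ->
  (forall t, 0 <= t <= 1 -> gamma t != z) ->
  exists2 e : R, 0 < e & forall t, 0 <= t <= 1 -> e <= sqdist (gamma t) z.
Proof.
move=> /closed_contour_piecewise pg gz.
apply: (piecewise_ind_itv pg (P := fun c d => exists2 e : R, 0 < e &
  forall t, c <= t <= d -> e <= sqdist (gamma t) z)); last first.
  move=> c d e cd de [e1 e10 h1] [e2 e20 h2].
  exists (Num.min e1 e2); first by rewrite lt_min e10.
  move=> t /andP[ct te]; rewrite ge_min; have [td|dt] := leP t d.
    by rewrite h1// ct.
  by rewrite h2 ?orbT// te ltW.
move=> a b a0 ab b1 /smooth_pieceP[u [v [du [dv [duv _ ge _]]]]].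
pose N t := (u t - complex.Re z) ^+ 2 + (v t - complex.Im z) ^+ 2.
have gN t : a <= t <= b -> sqdist (gamma t) z = N t by move=> tab; rewrite /sqdist ge.
have Nc : {within `[a, b], continuous N}.
  apply: continuous_subspaceT => t; have [/is_derive_continuous uc /is_derive_continuous vc] := duv t.
  by apply: cvgD; apply: cvgM; apply: cvgB => //; exact: cvg_cst.
have [m mab mN] := EVT_min (ltW ab) Nc.
have mab' : a <= m <= b by move: mab; rewrite in_itv.
exists (N m); first by rewrite -gN// sqdist_gt0 gz//; lra.
by move=> t tab; rewrite gN//; apply: mN; rewrite in_itv.
Qed.

Definition contour_integrable gamma (f : R[i] -> R[i]) :=
  mu.-integrable `[0, 1]
    (EFin \o (fun t => complex.Re (f (gamma t) * contour_deriv gamma t))) /\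
  mu.-integrable `[0, 1]
    (EFin \o (fun t => complex.Im (f (gamma t) * contour_deriv gamma t))).

End contours.

Section winding.
Variable R : realType.
Notation mu := (@lebesgue_measure R).
Implicit Types (a b c d t : R) (gamma : R -> R[i]) (z w : R[i]) (f g : R[i] -> R[i]).

Let continuous_subM (u f : R -> R) p t : {for t, continuous u} ->
  {for t, continuous f} -> {for t, continuous (fun s => (u s - p) * f s)}.
Proof. by move=> uc fc; apply: cvgM fc; apply: cvgB uc _; exact: cvg_cst. Qed.

Let continuous_subMD (u v f g : R -> R) p q t :
  {for t, continuous u} -> {for t, continuous f} ->
  {for t, continuous v} -> {for t, continuous g} ->
  {for t, continuous (fun s => (u s - p) * f s + (v s - q) * g s)}.
Proof.
by move=> uc fc vc gc; apply: cvgD; [exact: (continuous_subM (p := p) uc fc)|exact: (continuous_subM (p := q) vc gc)].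
Qed.

Let continuous_subMB (u v f g : R -> R) p q t :
  {for t, continuous u} -> {for t, continuous f} ->
  {for t, continuous v} -> {for t, continuous g} ->
  {for t, continuous (fun s => (u s - p) * f s - (v s - q) * g s)}.
Proof.
by move=> uc fc vc gc; apply: cvgB; [exact: (continuous_subM (p := p) uc fc)|exact: (continuous_subM (p := q) vc gc)].
Qed.

Let continuous_div_dist (n u v : R -> R) p q t :
  {for t, continuous n} -> {for t, continuous u} -> {for t, continuous v} ->
  (u t - p) ^+ 2 + (v t - q) ^+ 2 != 0 ->
  {for t, continuous (fun s => n s / ((u s - p) ^+ 2 + (v s - q) ^+ 2))}.
Proof.
move=> nc uc vc N0; apply: cvgM => //; apply: cvgV => //.
by apply: cvgD; apply: cvgM; apply: cvgB => //; exact: cvg_cst.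
Qed.

Lemma contour_integrable_inv gamma z : closed_contour gamma ->
  (forall t, 0 <= t <= 1 -> gamma t != z) ->
  contour_integrable gamma (fun zeta => (zeta - z)^-1).
Proof.
move=> /closed_contour_piecewise pg gz.
pose re t := complex.Re ((gamma t - z)^-1 * contour_deriv gamma t).
pose im t := complex.Im ((gamma t - z)^-1 * contour_deriv gamma t).
apply: (piecewise_ind_itv pg (P := fun c d => mu.-integrable `[c, d] (EFin \o re) /\
  mu.-integrable `[c, d] (EFin \o im))); last first.
  move=> c d e /ltW cd /ltW de [re1 im1] [re2 im2].
  by split; [exact: integrable_itv_cat re2|exact: integrable_itv_cat im2].
move=> a b a0 ab b1 /smooth_pieceP[u [v [du [dv [duv [duc dvc] ge dge]]]]].
have uc t : {for t, continuous u} by have [/is_derive_continuous] := duv t.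
have vc t : {for t, continuous v} by have [_ /is_derive_continuous] := duv t.
have N0 t : a <= t <= b ->
    (u t - complex.Re z) ^+ 2 + (v t - complex.Im z) ^+ 2 != 0.
  move=> tab; rewrite gt_eqF//; have := gz t; rewrite -sqdist_gt0 /sqdist ge// => -> //.
  by lra.
have tI t : t \in `[a, b]%classic -> a <= t <= b by rewrite inE /= in_itv.
have tIo t : t \in `]a, b[ -> a < t < b by rewrite in_itv.
split.
- apply: (@integrable_eq_oo _ a b re (fun t =>
    ((u t - complex.Re z) * du t + (v t - complex.Im z) * dv t) /
    ((u t - complex.Re z) ^+ 2 + (v t - complex.Im z) ^+ 2)) ab _ _).1.
    apply: continuous_in_subspaceT => t /tI /N0 Nt.
    exact: (continuous_div_dist (continuous_subMD (uc t) (duc t) (vc t) (dvc t)) (uc t) (vc t) Nt).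
  move=> t /tIo tab; rewrite /re Re_invM dge// ge; last by lra.
  by rewrite !raddfB.
- apply: (@integrable_eq_oo _ a b im (fun t =>
    ((u t - complex.Re z) * dv t - (v t - complex.Im z) * du t) /
    ((u t - complex.Re z) ^+ 2 + (v t - complex.Im z) ^+ 2)) ab _ _).1.
    apply: continuous_in_subspaceT => t /tI /N0 Nt.
    exact: (continuous_div_dist (continuous_subMB (uc t) (dvc t) (vc t) (duc t)) (uc t) (vc t) Nt).
  move=> t /tIo tab; rewrite /im Im_invM dge// ge; last by lra.
  by rewrite !raddfB.
Qed.

Let addcE a b c d : (a +i* b) + (c +i* d) = (a + c) +i* (b + d).
Proof. by []. Qed.

Let mulcE a b c d : (a +i* b) * (c +i* d) = (a * c - b * d) +i* (a * d + b * c).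
Proof. by []. Qed.

Lemma contour_integral_eq gamma f g :
  (forall t, 0 <= t <= 1 -> f (gamma t) = g (gamma t)) ->
  contour_integral gamma f = contour_integral gamma g.
Proof.
move=> fg; rewrite /contour_integral.
by congr (_ +i* _); apply: eq_Rintegral => t; rewrite inE /= in_itv /= => /fg ->.
Qed.

Lemma contour_integrableD gamma f g :
  contour_integrable gamma f -> contour_integrable gamma g ->
  contour_integrable gamma (fun zeta => f zeta + g zeta).
Proof.
move=> [fr fi] [gr gi]; split.
- apply: eq_integrable (integrableD _ fr gr) => //= t _ /=.
  by rewrite mulrDl raddfD.
- apply: eq_integrable (integrableD _ fi gi) => //= t _ /=.
  by rewrite mulrDl raddfD.
Qed.

Lemma contour_integralD gamma f g :
  contour_integrable gamma f -> contour_integrable gamma g ->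
  contour_integral gamma (fun zeta => f zeta + g zeta) =
  contour_integral gamma f + contour_integral gamma g.
Proof.
move=> [fr fi] [gr gi]; rewrite /contour_integral.
rewrite addcE -!RintegralD//.
by congr (_ +i* _); apply: eq_Rintegral => t _; rewrite mulrDl raddfD.
Qed.

Lemma contour_integrableZ gamma z f :
  contour_integrable gamma f -> contour_integrable gamma (fun zeta => z * f zeta).
Proof.
case: z => p q [fr fi]; split.
- apply: eq_integrable (integrableB _ (integrableZl _ p fr) (integrableZl _ q fi)) => //= t _.
  by rewrite -mulrA; case: (f _ * _).
- apply: eq_integrable (integrableD _ (integrableZl _ p fi) (integrableZl _ q fr)) => //= t _.
  by rewrite -mulrA; case: (f _ * _).
Qed.

Lemma contour_integralZ gamma z f : contour_integrable gamma f ->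
  contour_integral gamma (fun zeta => z * f zeta) = z * contour_integral gamma f.
Proof.
case: z => p q [fr fi]; rewrite /contour_integral.
rewrite mulcE -!RintegralZl// -RintegralB// -?RintegralD//.
- by congr (_ +i* _); apply: eq_Rintegral => t _; rewrite -mulrA; case: (f _ * _).
- exact: (integrableZl _ p fi).
- exact: (integrableZl _ q fr).
- exact: (integrableZl _ p fr).
- exact: (integrableZl _ q fi).
Qed.

Lemma contour_integrable0 gamma : contour_integrable gamma (fun=> 0).
Proof.
by split; apply: eq_integrable (integrable0 _ _) => // t _; rewrite /comp mul0r.
Qed.

Lemma contour_integral_sum gamma (I : Type) (r : seq I) (c : I -> R[i])
    (f : I -> R[i] -> R[i]) :
  (forall k, contour_integrable gamma (f k)) ->
  contour_integral gamma (fun zeta => \sum_(k <- r) c k * f k zeta) =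
  \sum_(k <- r) c k * contour_integral gamma (f k).
Proof.
move=> fi.
suff [] : contour_integrable gamma (fun zeta => \sum_(k <- r) c k * f k zeta) /\
  contour_integral gamma (fun zeta => \sum_(k <- r) c k * f k zeta) =
  \sum_(k <- r) c k * contour_integral gamma (f k) by [].
elim: r => [|k r [IH1 IH2]].
  under eq_fun do rewrite big_nil; rewrite big_nil; split; first exact: contour_integrable0.
  have := contour_integralZ 0 (contour_integrable0 gamma).
  by rewrite !mul0r.
have ki := contour_integrableZ (c k) (fi k).
under eq_fun do rewrite big_cons; rewrite big_cons; split; first exact: contour_integrableD.
by rewrite contour_integralD// contour_integralZ// IH2.
Qed.

Let ReB z w : complex.Re (z - w) = complex.Re z - complex.Re w.
Proof. exact: raddfB. Qed.

Let ImB z w : complex.Im (z - w) = complex.Im z - complex.Im w.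
Proof. exact: raddfB. Qed.

(** The hypothesis says that (zeta - w) / (zeta - z) is at distance less than 1
from 1 on the contour, so its logarithm G + i H is defined and smooth on each
piece.  Its increments telescope to 0 as the contour is closed. *)
Lemma winding_number_near gamma z w : closed_contour gamma ->
  (forall t, 0 <= t <= 1 -> sqdist w z < sqdist (gamma t) z) ->
  winding_number gamma w = winding_number gamma z.
Proof.
move=> cg gwz; rewrite /winding_number; congr (_ * _); apply/eqP; rewrite -subr_eq0; apply/eqP.
have sq_ge0 (p q : R[i]) : 0 <= sqdist p q by rewrite addr_ge0 ?sqr_ge0.
have gz t : 0 <= t <= 1 -> gamma t != z.
  by move=> /gwz /(le_lt_trans (sq_ge0 _ _)); rewrite sqdist_gt0.
have gw t : 0 <= t <= 1 -> gamma t != w.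
  by move=> /gwz; apply: contraTneq => ->; rewrite ltxx.
have pg := closed_contour_piecewise cg.
have [zr zi] := contour_integrable_inv cg gz.
have [wr wi] := contour_integrable_inv cg gw.
pose G t := ln (sqdist (gamma t) w) * 2^-1 - ln (sqdist (gamma t) z) * 2^-1.
pose A t := (complex.Re (gamma t) - complex.Re w) * (complex.Re (gamma t) - complex.Re z) +
  (complex.Im (gamma t) - complex.Im w) * (complex.Im (gamma t) - complex.Im z).
pose B t := (complex.Im (gamma t) - complex.Im w) * (complex.Re (gamma t) - complex.Re z) -
  (complex.Re (gamma t) - complex.Re w) * (complex.Im (gamma t) - complex.Im z).
pose H t := atan (B t / A t).
pose D t := (gamma t - w)^-1 * contour_deriv gamma t - (gamma t - z)^-1 * contour_deriv gamma t.
have A0 t : 0 <= t <= 1 -> 0 < A t.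
  move=> /gwz; rewrite /A /sqdist.
  set x := complex.Re (gamma t); set y := complex.Im (gamma t).
  have := sqr_ge0 (x - complex.Re w); have := sqr_ge0 (y - complex.Im w).
  by move: (complex.Re z) (complex.Im z) (complex.Re w) (complex.Im w) => p q r s; nra.
have [reD imD] : \int[mu]_(t in `[0, 1]) complex.Re (D t) = G 1 - G 0 /\
    \int[mu]_(t in `[0, 1]) complex.Im (D t) = H 1 - H 0.
  suff [] : mu.-integrable `[0, 1] (EFin \o (fun t => complex.Re (D t))) /\
    mu.-integrable `[0, 1] (EFin \o (fun t => complex.Im (D t))) /\
    \int[mu]_(t in `[0, 1]) complex.Re (D t) = G 1 - G 0 /\
    \int[mu]_(t in `[0, 1]) complex.Im (D t) = H 1 - H 0 by move=> _ [].
  pose P c d := mu.-integrable `[c, d] (EFin \o (fun t => complex.Re (D t))) /\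
    mu.-integrable `[c, d] (EFin \o (fun t => complex.Im (D t))) /\
    \int[mu]_(t in `[c, d]) complex.Re (D t) = G d - G c /\
    \int[mu]_(t in `[c, d]) complex.Im (D t) = H d - H c.
  apply: (piecewise_ind_itv pg (P := P)); last first.
    move=> c d e /ltW cd /ltW de [re1 [im1 [g1 h1]]] [re2 [im2 [g2 h2]]].
    have re := integrable_itv_cat cd de re1 re2.
    have im := integrable_itv_cat cd de im1 im2.
    split=> //; split=> //; split.
      by rewrite (Rintegral_itv_cat cd de re) g1 g2 addrC addrA subrK.
    by rewrite (Rintegral_itv_cat cd de im) h1 h2 addrC addrA subrK.
  move=> a b a0 ab b1 /smooth_pieceP[u [v [du [dv [duv [duc dvc] ge dge]]]]].
  have uc t : {for t, continuous u} by have [/is_derive_continuous] := duv t.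
  have vc t : {for t, continuous v} by have [_ /is_derive_continuous] := duv t.
  have N0 t (p : R[i]) : a <= t <= b -> gamma t != p ->
      0 < (u t - complex.Re p) ^+ 2 + (v t - complex.Im p) ^+ 2.
    by move=> tab; rewrite -sqdist_gt0 /sqdist ge.
  have t01 t : a <= t <= b -> 0 <= t <= 1 by move=> ?; lra.
  have tI t : t \in `[a, b]%classic -> a <= t <= b by rewrite inE /= in_itv.
  have tIo t : t \in `]a, b[ -> a < t < b by rewrite in_itv.
  have aab : a <= a <= b by lra.
  have abb : a <= b <= b by lra.
  pose r t := ((u t - complex.Re w) * du t + (v t - complex.Im w) * dv t) /
      ((u t - complex.Re w) ^+ 2 + (v t - complex.Im w) ^+ 2) -
    ((u t - complex.Re z) * du t + (v t - complex.Im z) * dv t) /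
      ((u t - complex.Re z) ^+ 2 + (v t - complex.Im z) ^+ 2).
  pose i t := ((u t - complex.Re w) * dv t - (v t - complex.Im w) * du t) /
      ((u t - complex.Re w) ^+ 2 + (v t - complex.Im w) ^+ 2) -
    ((u t - complex.Re z) * dv t - (v t - complex.Im z) * du t) /
      ((u t - complex.Re z) ^+ 2 + (v t - complex.Im z) ^+ 2).
  have rc : {within `[a, b], continuous r}.
    apply: continuous_in_subspaceT => t /tI tab; have t1 := t01 t tab.
    have Nw := lt0r_neq0 (N0 _ _ tab (gw _ t1)).
    have Nz := lt0r_neq0 (N0 _ _ tab (gz _ t1)).
    apply: cvgB; [exact:
      (continuous_div_dist (continuous_subMD (uc t) (duc t) (vc t) (dvc t)) (uc t) (vc t) Nw)|exact:
      (continuous_div_dist (continuous_subMD (uc t) (duc t) (vc t) (dvc t)) (uc t) (vc t) Nz)].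
  have ic : {within `[a, b], continuous i}.
    apply: continuous_in_subspaceT => t /tI tab; have t1 := t01 t tab.
    have Nw := lt0r_neq0 (N0 _ _ tab (gw _ t1)).
    have Nz := lt0r_neq0 (N0 _ _ tab (gz _ t1)).
    apply: cvgB; [exact:
      (continuous_div_dist (continuous_subMB (uc t) (dvc t) (vc t) (duc t)) (uc t) (vc t) Nw)|exact:
      (continuous_div_dist (continuous_subMB (uc t) (dvc t) (vc t) (duc t)) (uc t) (vc t) Nz)].
  have Dr : {in `]a, b[, (fun t => complex.Re (D t)) =1 r}.
    move=> t /tIo tab; rewrite /D ReB !Re_invM dge// ge; last by lra.
    by rewrite !raddfB.
  have Di : {in `]a, b[, (fun t => complex.Im (D t)) =1 i}.
    move=> t /tIo tab; rewrite /D ImB !Im_invM dge// ge; last by lra.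
    by rewrite !raddfB.
  split; first exact: (integrable_eq_oo ab rc Dr).1.
  split; first exact: (integrable_eq_oo ab ic Di).1.
  split.
    rewrite /G /sqdist (ge _ aab) (ge _ abb).
    apply: (Rintegral_FTC (F := fun t =>
      ln ((u t - complex.Re w) ^+ 2 + (v t - complex.Im w) ^+ 2) * 2^-1 -
      ln ((u t - complex.Re z) ^+ 2 + (v t - complex.Im z) ^+ 2) * 2^-1) ab _ rc Dr).
    move=> t tab; have t1 := t01 t tab; have [hu hv] := duv t.
    exact: (is_deriveB (is_derive_ln_dist hu hv (N0 _ _ tab (gw _ t1)))
      (is_derive_ln_dist hu hv (N0 _ _ tab (gz _ t1)))).
  rewrite /H /A /B (ge _ aab) (ge _ abb).
  apply: (Rintegral_FTC (F := fun t =>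
    atan (((v t - complex.Im w) * (u t - complex.Re z) -
           (u t - complex.Re w) * (v t - complex.Im z)) /
          ((u t - complex.Re w) * (u t - complex.Re z) +
           (v t - complex.Im w) * (v t - complex.Im z)))) ab _ ic Di).
  move=> t tab; have t1 := t01 t tab; have [hu hv] := duv t.
  apply: is_derive_arg_ratio => //.
  by have := A0 t t1; rewrite /A (ge _ tab).
have zero : forall p q : R, p = 0 -> q = 0 -> p +i* q = 0 by move=> ? ? -> ->.
have c01 : gamma 1 = gamma 0 by case: cg.
rewrite /contour_integral.
apply: zero.
  rewrite -RintegralB//; transitivity (\int[mu]_(t in `[0, 1]) complex.Re (D t)).
    by apply: eq_Rintegral => t _; rewrite /D raddfB.
  by rewrite reD /G c01 subrr.
rewrite -RintegralB//; transitivity (\int[mu]_(t in `[0, 1]) complex.Im (D t)).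
  by apply: eq_Rintegral => t _; rewrite /D raddfB.
by rewrite imD /H /A /B c01 subrr.
Qed.

End winding.

(** * Total eigenprojectors of Hermitian matrices *)

Section eigenprojector.
Variables (R : realType) (N : nat).
Implicit Types (gamma : R -> R[i]) (V B : 'M[R[i]]_N) (e : 'rV[R[i]]_N).

Lemma invmx_diagonalized V e (zeta : R[i]) : V \in unitmx ->
  (forall k, e 0 k != zeta) ->
  invmx (invmx V *m diag_mx e *m V - zeta%:M) =
  invmx V *m diag_mx (\row_k (e 0 k - zeta)^-1) *m V.
Proof.
move=> Vu ez.
have -> : invmx V *m diag_mx e *m V - zeta%:M =
    invmx V *m diag_mx (\row_k (e 0 k - zeta)) *m V.
  have -> : zeta%:M = invmx V *m (zeta%:M : 'M[R[i]]_N) *m V.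
    by rewrite scalar_mxC -mulmxA mulVmx// mulmx1.
  rewrite -mulmxBl -mulmxBr; congr (_ *m _ *m _).
  by apply/matrixP => i j; rewrite !mxE; case: eqP => [->|_] /=; rewrite ?mulr1n ?mulr0n ?subrr.
set M := (X in invmx X); set M' := (X in _ = X).
have MM' : M *m M' = 1%:M.
  rewrite /M /M' -!mulmxA (mulmxA V (invmx V)) mulmxV// mul1mx (mulmxA (diag_mx _)) mulmx_diag.
  rewrite (_ : \row_j _ = const_mx 1).
    by rewrite diag_const_mx mul1mx mulVmx.
  by apply/rowP => k; rewrite !mxE divff// subr_eq0.
by rewrite -[LHS]mulmx1 -MM' mulmxA mulVmx ?mul1mx//; case: (mulmx1_unit MM').
Qed.

(** In the basis given by V the resolvent is diagonal, so that the Riesz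
integral reduces to the scalar integrals of 1 / (zeta - e_k). *)
Lemma total_eigenprojector_diagonalized (d : nat) gamma (A : 'rV[R]_d -> 'M[R[i]]_N)
    mu V e : closed_contour gamma -> V \in unitmx ->
  A mu = invmx V *m diag_mx e *m V ->
  (forall k t, 0 <= t <= 1 -> gamma t != e 0 k) ->
  total_eigenprojector gamma A mu =
  invmx V *m diag_mx (\row_k winding_number gamma (e 0 k)) *m V.
Proof.
move=> cg Vu Amu ge; apply/matrixP => i j; rewrite [LHS]mxE.
transitivity (- 1 / two_pi_i R * contour_integral gamma
    (fun zeta => \sum_k (- (invmx V i k * V k j)) * (zeta - e 0 k)^-1)).
  congr (_ * _); apply: contour_integral_eq => t t01.
  rewrite Amu invmx_diagonalized//; last by move=> k; rewrite eq_sym ge.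
  rewrite mul_mx_diag mxE; apply: eq_bigr => k _; rewrite !mxE.
  by rewrite -(opprB (gamma t)) invrN; ring.
rewrite contour_integral_sum; last by move=> k; apply: contour_integrable_inv => // t; exact: ge.
rewrite mul_mx_diag mxE mulr_sumr; apply: eq_bigr => k _; rewrite !mxE /winding_number.
by ring.
Qed.

Lemma eigenvalue_diagonalized V e k : V \in unitmx ->
  eigenvalue (invmx V *m diag_mx e *m V) (e 0 k).
Proof.
move=> Vu; apply/eigenvalueP; exists (row k V).
  rewrite rowE -!mulmxA (mulmxA V) mulmxV// mul1mx mulmxA.
  have -> : (delta_mx 0 k : 'rV[R[i]]_N) *m diag_mx e = e 0 k *: delta_mx 0 k.
    apply/rowP => j; rewrite mul_mx_diag !mxE mulrC /=.
    by case: eqP => [->//|_]; rewrite !mulr0.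
  by rewrite -scalemxAl.
rewrite rowE; apply/eqP => /(congr1 (mulmx^~ (invmx V))).
rewrite -mulmxA mulmxV// mulmx1 mul0mx => /rowP /(_ k).
by rewrite !mxE !eqxx => /eqP; rewrite oner_eq0.
Qed.

(** In the basis given by V, an eigenvector u satisfies
u (V B V^-1) = ((l - e_k) u_k)_k; if all |l - e_k| exceeded the norm of
V B V^-1, the left-hand side would be too small. *)
Lemma bauer_fike V e B (l : R[i]) : V \in unitmx ->
  eigenvalue (invmx V *m diag_mx e *m V + B) l ->
  exists k, normc (l - e 0 k) <= l1norm (V *m B *m invmx V).
Proof.
move=> Vu /eigenvalueP[v vA v0]; apply: contrapT => /forallNP H.
set nu := l1norm _ in H.
have {}H k : nu < normc (l - e 0 k) by rewrite ltNge; apply/negP.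
pose u := v *m invmx V.
have uE : u *m (V *m B *m invmx V) = \row_k ((l - e 0 k) * u 0 k).
  have h : u *m diag_mx e + u *m (V *m B *m invmx V) = l *: u.
    have -> : l *: u = v *m (invmx V *m diag_mx e *m V + B) *m invmx V.
      by rewrite vA -scalemxAl.
    rewrite mulmxDr mulmxDl; congr (_ + _).
      by rewrite -[in RHS](mulmxA v) -(mulmxA _ V) mulmxV// mulmx1 mulmxA.
    by rewrite !mulmxA /u -(mulmxA v (invmx V)) mulVmx// mulmx1.
  apply/rowP => k; move: h; move: (u *m (V *m B *m invmx V)) => X /rowP/(_ k).
  by rewrite mul_mx_diag !mxE mulrBl => <-; ring.
have : \sum_k (normc (l - e 0 k) - nu) * normc (u 0 k) <= 0.
  have := l1normM u (V *m B *m invmx V); rewrite uE {1 2}/l1norm !big_ord1 -/nu.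
  rewrite mulr_suml -subr_le0 -sumrB; apply: le_trans.
  have rE k : (\row_j ((l - e 0 j) * u 0 j)) 0 k = (l - e 0 k) * u 0 k by rewrite mxE.
  by apply: ler_sum => k _; rewrite rE normcM; lra.
have term_ge0 k : 0 <= (normc (l - e 0 k) - nu) * normc (u 0 k).
  by rewrite mulr_ge0 ?normc_ge0// subr_ge0 ltW.
move=> sum_le0.
have : \sum_k (normc (l - e 0 k) - nu) * normc (u 0 k) == 0.
  by rewrite eq_le sum_le0 sumr_ge0.
rewrite psumr_eq0 => [/allP u0|k _]; last exact: term_ge0.
move/eqP: v0; apply.
have -> : v = u *m V by rewrite /u -mulmxA mulVmx// mulmx1.
suff -> : u = 0 by rewrite mul0mx.
apply/rowP => k; rewrite [RHS]mxE; apply: eq0_normc.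
have /eqP := u0 k (mem_index_enum k) => /eqP /=.
by rewrite mulf_eq0 subr_eq0 gt_eqF ?H//= => /eqP.
Qed.

Lemma herm_diagonalized (A : 'M[R[i]]_N) : A \is hermsymmx ->
  exists V e, V \in unitmx /\ A = invmx V *m diag_mx e *m V.
Proof.
move=> /hermitian_normalmx /orthomx_spectralP AE.
by exists (spectralmx A), (spectral_diag A); split=> //; exact: spectral_unit.
Qed.

Lemma encircles_only_gap gamma (A0 : 'M[R[i]]_N) (lambda0 : R[i]) e :
  encircles_only gamma A0 lambda0 -> (forall k, eigenvalue A0 (e 0 k)) ->
  exists2 delta : R, 0 < delta &
    forall k t, 0 <= t <= 1 -> delta <= sqdist (gamma t) (e 0 k).
Proof.
move=> [cg gA _ _] eA.
have /choice[f fP] (k : 'I_N) : exists dk : R, 0 < dk /\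
    forall t, 0 <= t <= 1 -> dk <= sqdist (gamma t) (e 0 k).
  have [dk dk0 dkP] := contour_gap cg (gA _ (eA k)).
  by exists dk.
exists (\big[Num.min/1]_k f k).
  by apply: lt_bigmin => // k _; have [] := fP k.
move=> k t t01; have [_ /(_ t t01)] := fP k; apply: le_trans.
exact: bigmin_le.
Qed.

(** For A(mu) close to A(mu0), each eigenvalue of A(mu) is so close to one of
A(mu0) that it has the same winding number, which is 0 or 1. *)
Lemma total_eigenprojector_idem (d : nat) gamma (A : 'rV[R]_d -> 'M[R[i]]_N)
    (mu0 : 'rV[R]_d) (lambda0 : R[i]) :
  A mu0 \is hermsymmx -> encircles_only gamma (A mu0) lambda0 ->
  exists2 eta : R, 0 < eta & forall mu, A mu \is hermsymmx ->
    l1norm (A mu - A mu0) <= eta ->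
    total_eigenprojector gamma A mu *m total_eigenprojector gamma A mu =
    total_eigenprojector gamma A mu.
Proof.
move=> /herm_diagonalized[V0 [e0 [V0u A0E]]] genc.
have eA k : eigenvalue (A mu0) (e0 0 k) by rewrite A0E eigenvalue_diagonalized.
have [delta delta0 deltaP] := encircles_only_gap genc eA.
have [cg _ w1 w0] := genc.
pose c := l1norm V0 * l1norm (invmx V0) + 1.
have c0 : 0 < c by rewrite ltr_wpDl// mulr_ge0 ?l1norm_ge0.
(* A distance at most rho has square at most delta / 2, since rho <= 1. *)
pose rho := Num.min 1 (delta / 2).
have rho0 : 0 < rho by rewrite lt_min ltr01 divr_gt0.
exists (rho / c); first by rewrite divr_gt0.
move=> mu /herm_diagonalized[V [e [Vu AE]]] muE.
have near_e0 j : exists k, sqdist (e 0 j) (e0 0 k) < delta.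
  have : eigenvalue (invmx V0 *m diag_mx e0 *m V0 + (A mu - A mu0)) (e 0 j).
    by rewrite -A0E addrC subrK AE eigenvalue_diagonalized.
  move=> /(bauer_fike V0u)[k hk]; exists k; rewrite sqdistE.
  have h1 : normc (e 0 j - e0 0 k) <= rho.
    apply: (le_trans hk); apply: (le_trans (l1normM _ _)).
    have h2 := l1normM V0 (A mu - A mu0).
    have h3 := ler_wpM2r (l1norm_ge0 (invmx V0)) h2.
    apply: (le_trans h3); rewrite mulrAC.
    have : c * l1norm (A mu - A mu0) <= rho by rewrite mulrC -ler_pdivlMr.
    by rewrite /c; have := l1norm_ge0 (A mu - A mu0); nra.
  have := normc_ge0 (e 0 j - e0 0 k).
  have : rho <= 1 by rewrite ge_min lexx.
  have : rho <= delta / 2 by rewrite ge_min lexx orbT.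
  by move: h1; set x := normc _; nra.
have w01 j : winding_number gamma (e 0 j) = 0 \/ winding_number gamma (e 0 j) = 1.
  have [k ek] := near_e0 j.
  rewrite (winding_number_near cg (z := e0 0 k)).
    by have [->|] := eqVneq (e0 0 k) lambda0; [right|left; exact: w0].
  by move=> t t01; apply: lt_le_trans ek _; exact: deltaP.
have ge j t : 0 <= t <= 1 -> gamma t != e 0 j.
  move=> t01; have [k ek] := near_e0 j; apply/eqP => gte.
  by have := deltaP k t t01; rewrite gte leNgt ek.
rewrite (total_eigenprojector_diagonalized cg Vu AE ge).
rewrite -!mulmxA (mulmxA V (invmx V)) mulmxV// mul1mx (mulmxA (diag_mx _)) mulmx_diag.
congr (_ *m (diag_mx _ *m _)); apply/rowP => k; rewrite !mxE.
by case: (w01 k) => ->; rewrite ?mulr0 ?mulr1.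
Qed.

Lemma mulmx_ext m n (A B : 'M[R[i]]_(m, n)) :
  (forall v : 'cV_n, A *m v = B *m v) -> A = B.
Proof. by move=> AB; apply/trmx_inj/row_matrixP => j; rewrite -!tr_col !colE AB. Qed.

(** The Riesz integral Q at mu0 has its range in the eigenspace, so P0 Q = Q.
Taking adjoints, P0 A(mu0) = lambda0 P0, so the columns of P0 V^-1 at the
other eigenvalues are zero and P0 Q = P0. *)
Lemma total_eigenprojector_center (d : nat) gamma (A : 'rV[R]_d -> 'M[R[i]]_N)
    (mu0 : 'rV[R]_d) (lambda0 : R[i]) (P0 : 'M[R[i]]_N) :
  A mu0 \is hermsymmx -> encircles_only gamma (A mu0) lambda0 ->
  orthogonal_eigenprojector (A mu0) lambda0 P0 ->
  total_eigenprojector gamma A mu0 = P0.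
Proof.
move=> A0h genc [P0P0 P0adj ranP0].
have [V [e [Vu A0E]]] := herm_diagonalized A0h.
have eA k : eigenvalue (A mu0) (e 0 k) by rewrite A0E eigenvalue_diagonalized.
have [cg gA w1 w0] := genc.
rewrite (total_eigenprojector_diagonalized cg Vu A0E) => [|k t t01]; last exact: gA.
set w := \row_k _; set Q := _ *m _ *m _.
have wE k : w 0 k = (e 0 k == lambda0)%:R.
  by rewrite mxE; have [->|/w0->//] := eqVneq (e 0 k) lambda0.
have P0Q : P0 *m Q = Q.
  apply: mulmx_ext => v; rewrite -mulmxA.
  have /= [u _ <-] : ran P0 (Q *m v).
    rewrite ranP0 /= mulmxA scalemxAl; congr (_ *m _).
    rewrite /Q A0E -!mulmxA (mulmxA V (invmx V)) mulmxV// mul1mx (mulmxA (diag_mx e)) mulmx_diag.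
    rewrite scalemxAr scalemxAl; congr (_ *m (_ *m _)).
    rewrite -linearZ /=; congr diag_mx; apply/rowP => k; rewrite !mxE.
    by have := wE k; rewrite mxE => ->; case: eqP => [->|_]; rewrite ?mulr0 ?mulr1.
  by rewrite mulmxA P0P0.
have AP0 : A mu0 *m P0 = lambda0 *: P0.
  apply: mulmx_ext => v; rewrite -mulmxA -scalemxAl.
  have : ran P0 (P0 *m v) by exists v.
  by rewrite ranP0.
have P0A : P0 *m A mu0 = lambda0 *: P0.
  have A0adj : (A mu0) ^t* = A mu0.
    by have /is_hermitianmxP := A0h; rewrite expr0 scale1r => <-.
  (* Taking adjoints in A(mu0) P0 = lambda0 P0 brings in the conjugate of
     lambda0; comparing the two expressions of P0 A(mu0) P0 removes it. *)
  have adj : P0 *m A mu0 = Num.conj lambda0 *: P0.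
    have := congr1 (fun M : 'M[R[i]]_N => map_mx Num.conj (trmx M)) AP0.
    by rewrite trmx_mul map_mxM A0adj P0adj linearZ /= map_mxZ P0adj.
  by rewrite adj -{1}P0P0 scalemxAl -adj -mulmxA AP0 -scalemxAr P0P0.
have P0Q' : P0 *m Q = P0.
  have : P0 *m invmx V *m diag_mx w = P0 *m invmx V.
    have : P0 *m invmx V *m diag_mx e = lambda0 *: (P0 *m invmx V).
      by rewrite scalemxAl -P0A A0E -!mulmxA mulmxV// mulmx1.
    move: (P0 *m invmx V) => X; rewrite !mul_mx_diag => /matrixP h.
    apply/matrixP => i k; have {h} := h i k; rewrite !mxE; have := wE k; rewrite mxE => ->.
    have [_|ne] := eqVneq (e 0 k) lambda0; first by rewrite mulr1.
    rewrite mulr0 mulrC => /eqP; rewrite -subr_eq0 -mulrBl mulf_eq0 subr_eq0.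
    by rewrite (negbTE ne) /= => /eqP.
  by rewrite /Q mulmxA mulmxA => ->; rewrite -mulmxA mulVmx// mulmx1.
by rewrite -P0Q.
Qed.

End eigenprojector.

(** * A projector near an orthogonal projector *)

Section projectors.
Variables (R : realType) (N m0 : nat) (P : R -> 'M[R[i]]_N) (P0 : 'M[R[i]]_N)
  (U0 : 'M[R[i]]_(N, m0)).
Hypotheses (U0U0 : U0 ^t* *m U0 = 1%:M) (U0P0 : U0 *m U0 ^t* = P0).
Hypothesis P_near : vanishes_to_order 1 (fun t => P t - P0).
Hypothesis P_idem : near0_right (fun t => P t *m P t = P t).

(** From P P = P one gets P (1 - (P - P0)) = P P0, and P P0 = P U0 U0^*. *)
Lemma projector_factor : exists M : R -> 'M[R[i]]_(m0, N),
  vanishes_to_order 0 M /\ near0_right (fun t => P t = P t *m U0 *m M t).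
Proof.
have [Wu Wb] := vanishes_invmx P_near.
exists (fun t => U0 ^t* *m invmx (1%:M - (P t - P0))); split.
  exact: (vanishesM (vanishes_cst (U0 ^t*)) Wb).
apply: near0_right_imp (near0_rightI P_idem Wu) => t [PP WU].
have PW : P t *m (1%:M - (P t - P0)) = P t *m P0.
  by rewrite !mulmxBr mulmx1 PP opprB addrC subrK.
by rewrite mulmxA -(mulmxA (P t)) U0P0 -PW mulmxK.
Qed.

Lemma compression_near_id :
  exists E : R -> 'M[R[i]]_m0, vanishes_to_order 1 E /\
    forall t, U0 ^t* *m P t *m U0 = 1%:M - E t.
Proof.
exists (fun t => - (U0 ^t* *m (P t - P0) *m U0)); split.
  have := vanishesM (vanishesM (vanishes_cst (- U0 ^t*)) P_near) (vanishes_cst U0).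
  by under eq_fun do rewrite !mulNmx.
move=> t; rewrite opprK mulmxBr mulmxBl -U0P0 !mulmxA U0U0 mul1mx U0U0.
by rewrite addrC subrK.
Qed.

(** The range of P t is the graph of a map defined on the range of P0; the
second factor is the component along U0. *)
Lemma graph_factor t :
  U0 ^t* *m P t *m U0 \in unitmx ->
  P t *m U0 = (U0 + (1%:M - P0) *m (P t *m U0) *m invmx (U0 ^t* *m P t *m U0)) *m
              (U0 ^t* *m P t *m U0).
Proof.
move=> Cu; rewrite [RHS]mulmxDl mulmxKV// mulmxBl mul1mx -U0P0 !mulmxA.
by rewrite addrC subrK.
Qed.

End projectors.

(** * Equality of the three spans *)

Theorem theorem4p8 (R : realType) (d N m0 : nat)
    (D : set 'rV[R]_d) (mu0 : 'rV[R]_d)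
    (A : 'rV[R]_d -> 'M[R[i]]_N)
    (lambda0 : R[i]) (gamma : R -> R[i])
    (P0 : 'M[R[i]]_N) (U0 : 'M[R[i]]_(N, m0))
    (P0coef : multi_index d -> 'M[R[i]]_N)
    (Kcoef : multi_index d -> 'M[R[i]]_(N, m0))
    (D_open : open D) (D_mu0 : D mu0)
    (A_herm : forall mu, D mu -> A mu \is hermsymmx)
    (A_analytic : real_analytic_on D A)
    (lambda0_eig : eigenvalue (A mu0) lambda0)
    (lambda0_mult : mup lambda0 (char_poly (A mu0)) = m0)
    (P0_proj : orthogonal_eigenprojector (A mu0) lambda0 P0)
    (gamma_enc : encircles_only gamma (A mu0) lambda0)
    (U0_orthonormal : U0 ^t* *m U0 = 1%:M)
    (U0_P0 : U0 *m U0 ^t* = P0)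
    (P0coef_taylor : has_power_series (total_eigenprojector gamma A) mu0 P0coef)
    (Kcoef_taylor :
       has_power_series (Kmx (total_eigenprojector gamma A) P0 U0) mu0 Kcoef) :
  forall n : nat,
    lin_span (\bigcup_(b in [set b | (mdegree b <= n)%N]) ran (P0coef b)) =
      lin_span (\bigcup_(b in [set b | (mdegree b <= n)%N]) ran (P0coef b *m U0))
    /\
    lin_span (\bigcup_(b in [set b | (mdegree b <= n)%N]) ran (P0coef b *m U0)) =
      lin_span (ran U0 `|`
                \bigcup_(b in [set b | (mdegree b <= n)%N]) ran (Kcoef b)).
Proof.
move=> n; pose h t : 'rV[R]_d := mu0 + wcurve d n t.
pose Pmu := total_eigenprojector gamma A; pose P t := Pmu (h t).
pose K t := Kmx Pmu P0 U0 (h t); pose C t := U0 ^t* *m P t *m U0.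
pose E := (n.+1 * n.+1 ^ d.+1)%N.
have Psum := has_power_series_sums P0coef_taylor.
have Ksum := has_power_series_sums Kcoef_taylor.
have Pmu0 : Pmu mu0 = P0.
  exact: total_eigenprojector_center (A_herm _ D_mu0) gamma_enc P0_proj.
have P_near : vanishes_to_order 1 (fun t => P t - P0).
  by rewrite -Pmu0; exact: (has_sums_cont n Psum).
have P_idem : near0_right (fun t => P t *m P t = P t).
  have [eta eta0 etaP] := total_eigenprojector_idem (A_herm _ D_mu0) gamma_enc.
  have [a /has_power_series_sums asum] := A_analytic _ D_mu0.
  have A_near := vanishes_small eta0 (has_sums_cont n asum).
  have D_near := wcurve_near n (open_nbhs_nbhs (conj D_open D_mu0)).
  by apply: near0_right_imp (near0_rightI A_near D_near) => t [/etaP H /A_herm].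
have [M [M0 PM]] := projector_factor U0_P0 P_near P_idem.
have [F [F1 CF]] := compression_near_id U0_orthonormal U0_P0 P_near.
have [Cu Cinv] := vanishes_invmx F1.
have C0 : vanishes_to_order 0 C.
  apply: vanishes_eq (vanishesD (vanishes_cst 1%:M) (vanishesM (vanishes_cst (- 1%:M)) (vanishes_le _ F1))).
    by exists 1; [exact: ltr01|move=> t _]; rewrite /C CF mulNmx mul1mx.
  by [].
have PUK : near0_right (fun t => P t *m U0 = (U0 + K t) *m C t).
  apply: near0_right_imp Cu => t; rewrite -CF => Ct.
  exact: (graph_factor (P := P) U0_P0 Ct).
have UK : near0_right (fun t => U0 + K t = P t *m U0 *m invmx (1%:M - F t)).
  apply: near0_right_imp (near0_rightI Cu PUK) => t [Ct ->].
  by rewrite /C CF mulmxK.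
have PU_iff (w : 'rV_N) : (forall b, (mdegree b <= n)%N -> w *m P0coef b *m U0 = 0) <->
    vanishes_to_order E (fun t => w *m P t *m U0).
  exact: has_sums_vanishesP n (has_sums_mul w U0 Psum).
have P_iff (w : 'rV_N) : (forall b, (mdegree b <= n)%N -> w *m P0coef b = 0) <->
    vanishes_to_order E (fun t => w *m P t).
  exact: has_sums_vanishesP n (has_sums_mull w Psum).
have K_iff (w : 'rV_N) : (forall b, (mdegree b <= n)%N -> w *m Kcoef b = 0) <->
    vanishes_to_order E (fun t => w *m K t).
  exact: has_sums_vanishesP n (has_sums_mull w Ksum).
split; apply/seteqP; split; apply: lin_span_subset => w.
- move=> /annihilates_bigcup_ranP PU0; apply/annihilates_bigcup_ranP.
  have wPU0 : vanishes_to_order E (fun t => w *m P t *m U0).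
    by apply/(PU_iff w) => b bn; rewrite -mulmxA; exact: PU0.
  apply/(P_iff w); rewrite -[E in vanishes_to_order E]addn0.
  apply: vanishes_eq (vanishesM wPU0 M0).
  by apply: near0_right_imp PM => t PMt; rewrite [in RHS]PMt !mulmxA.
- move=> /annihilates_bigcup_ranP Pw; apply/annihilates_bigcup_ranP => b bn.
  by rewrite mulmxA Pw ?mul0mx.
- move=> Kw; apply/annihilates_bigcup_ranP => b bn; rewrite mulmxA.
  have wU0 : w *m U0 = 0 by apply/annihilates_ranP => u uU0; apply: Kw; left.
  have wK : vanishes_to_order E (fun t => w *m K t).
    apply/(K_iff w); apply/annihilates_bigcup_ranP => u uK; apply: Kw; right.
    exact: uK.
  move: b bn; apply/(PU_iff w); rewrite -[E in vanishes_to_order E]addn0.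
  apply: vanishes_eq (vanishesM wK C0).
  apply: near0_right_imp PUK => t PUKt.
  by rewrite -[RHS]mulmxA PUKt mulmxA mulmxDr wU0 add0r.
- move=> /annihilates_bigcup_ranP PU0.
  have wPU0 : vanishes_to_order E (fun t => w *m P t *m U0).
    by apply/(PU_iff w) => b bn; rewrite -mulmxA; exact: PU0.
  (* The value at t = 0 vanishes too, and there P U0 = P0 U0 = U0. *)
  have wU0 : w *m U0 = 0.
    have E_gt0 : (0 < E)%N by rewrite muln_gt0 expn_gt0.
    have := vanishes_at0 (vanishes_le E_gt0 wPU0).
    by rewrite /P /h wcurve0 addr0 Pmu0 -U0_P0 -!mulmxA U0_orthonormal mulmx1.
  move=> u [[v _ <-]|]; first by rewrite mulmxA wU0 mul0mx.
  move: u; apply/annihilates_bigcup_ranP; apply/(K_iff w).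
  rewrite -[E in vanishes_to_order E]addn0.
  apply: vanishes_eq (vanishesM wPU0 Cinv).
  apply: near0_right_imp UK => t UKt.
  by rewrite -!mulmxA [P t *m _]mulmxA -UKt mulmxDr wU0 add0r.
Qed.
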